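(* Let $(X,\mathscr A,\mu)$ be a $\sigma$-finite measure space, let $\phi\colon X\to X$ and $w\colon X\to\mathbb C$ be $\mathscr A$-measurable, and assume that $C_\phi$ and $C_{\phi,w}$ are densely defined in $L^2(\mu)$. Assume that $0<|w|<\beta$ a.e. $[\mu]$ for some $\beta\in(0,+\infty)$. Then $$\mathcal D(C_{\phi,w}^\dag)=\Big\{f\in L^2(\mu)\colon \frac{\mathsf E_\phi(f\bar w)\circ\phi^{-1}}{\mathsf E_\phi(|w|^2)\circ\phi^{-1}}\in L^2(\mu)\Big\},$$ $$C_{\phi,w}^\dag f=\frac{\mathsf E_\phi(f\bar w)\circ\phi^{-1}}{\mathsf E_\phi(|w|^2)\circ\phi^{-1}},\quad f\in\mathcal D(C_{\phi,w}^\dag).$$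
   Context: Notation: $\mathcal D(T)$, $\mathcal N(T)$, $\mathcal R(T)$ are the domain, kernel and range of an operator $T$; $L^2(\mu)$ is the complex Hilbert space of square $\mu$-integrable $\mathscr A$-measurable complex functions on $X$. Conventions: $\frac10=\infty$, $0\cdot\infty=0$ (so $\frac00=0$). Weighted composition operators. Put $\mu_w(\sigma)=\int_\sigma|w|^2\,d\mu$ and $\mu_w\circ\phi^{-1}(\sigma)=\mu_w(\phi^{-1}(\sigma))$ for $\sigma\in\mathscr A$. If $\mu_w\circ\phi^{-1}$ is absolutely continuous with respect to $\mu$, then $C_{\phi,w}$ is said to be well-defined and is the operator in $L^2(\mu)$ with $\mathcal D(C_{\phi,w})=\{f\in L^2(\mu)\colon w\cdot(f\circ\phi)\in L^2(\mu)\}$, $C_{\phi,w}f=w\cdot(f\circ\phi)$ (it is closed). ''Densely defined'' includes being well-defined. The composition operator is $C_\phi:=C_{\phi,\mathbf 1}$, where $\mathbf 1$ is the constant function $1$. $\mathsf h_\phi\colon X\to[0,\infty]$ is the Radon–Nikodym derivative of $\mu\circ\phi^{-1}$: $\mu(\phi^{-1}(\Delta))=\int_\Delta\mathsf h_\phi\,d\mu$ for $\Delta\in\mathscr A$. Conditional expectation. When $C_\phi$ is densely defined, for an $\mathscr A$-measurable $f\colon X\to[0,\infty]$, or $f\in L^p(\mu)$ with $1\le p<\infty$, $\mathsf E_\phi(f)$ is the conditional expectation of $f$ with respect to the $\sigma$-algebra $\phi^{-1}(\mathscr A)$ and the measure $\mu$; $\mathsf E_\phi(f)\circ\phi^{-1}$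 denotes the unique (up to $\mu$-null sets) $\mathscr A$-measurable function $g$ on $X$ such that $g=0$ a.e. $[\mu]$ on $\{\mathsf h_\phi=0\}$ and $\mathsf E_\phi(f)=g\circ\phi$ a.e. $[\mu]$. Reciprocal. Let $T$ be a linear operator in a Hilbert space $\mathcal H$ with $\mathcal D(T)=\mathcal N(T)\oplus(\mathcal D(T)\cap\mathcal N(T)^\perp)$ (this holds for closed $T$). The reciprocal $T^\dag$ is the unique densely defined operator with domain $\mathcal D(T^\dag)=\mathcal R(T)\oplus\mathcal R(T)^\perp$ such that $TT^\dag f=P_{\overline{\mathcal R(T)}}f$ for $f\in\mathcal D(T^\dag)$, $T^\dag Tg=P_{\mathcal N(T)^\perp}g$ for $g\in\mathcal D(T)$, and $\mathcal N(T^\dag)=\mathcal R(T)^\perp$, where $P_M$ is the orthogonal projection onto the closed subspace $M$. *)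

(* Defs.v *)
From HB Require Import structures.
From mathcomp Require Import all_boot all_order all_algebra.
From mathcomp Require Import all_classical all_reals all_analysis.
From mathcomp Require Import complex sesquilinear generic_quotient ring_quotient.
From mathcomp Require Import measurable_realfun.
From mathcomp Require Import ring lra.

Set Implicit Arguments.
Unset Strict Implicit.
Unset Printing Implicit Defensive.

Import Order.TTheory GRing.Theory Num.Theory Num.Def.
Import Normc.

Local Open Scope ring_scope.
Local Open Scope classical_set_scope.
Local Open Scope quotient_scope.

(* An operator in H is identified with its graph, a set of pairs (f, T f),
   so an equality of operators includes that of their domains. *)
Section operators.
Context {C : numClosedFieldType} {H : lmodType C}.
Implicit Types (M N : set H) (S T : set (H * H)).

Definition linear_subspace {V : lmodType C} (G : set V) :=
  G 0 /\ forall a u v, G u -> G v -> G (a *: u + v).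

Definition linear_operator T :=
  linear_subspace T /\ forall f g g', T (f, g) -> T (f, g') -> g = g'.

Definition op_dom T : set H := [set f | exists g, T (f, g)].
Definition op_range T : set H := [set g | exists f, T (f, g)].
Definition op_ker T : set H := [set f | T (f, 0)].

(* S after T *)
Definition op_comp S T : set (H * H) :=
  [set fh | exists2 g, T (fh.1, g) & S (g, fh.2)].

Definition subspace_sum M N : set H := [set f + g | f in M & g in N].

Variable dot : {dot H for (@conjC C : C -> C)}.

Definition orthogonal_complement M : set H :=
  [set f | forall g, M g -> dot f g = 0].

Definition norm_closure M : set H := [set f |
  forall e : C, 0 < e -> exists2 g, M g & dot (f - g) (f - g) < e ^+ 2].

Definition norm_dense M := norm_closure M = setT.

(* graph of the orthogonal projection onto a closed subspace M *)
Definition orthogonal_projection M : set (H * H) :=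
  [set fp | M fp.2 /\ orthogonal_complement M (fp.1 - fp.2)].

Definition is_reciprocal T S :=
  [/\ linear_operator S /\ norm_dense (op_dom S),
      op_dom S =
        subspace_sum (op_range T) (orthogonal_complement (op_range T)),
      forall f, op_dom S f -> exists2 p, op_comp T S (f, p) &
        orthogonal_projection (norm_closure (op_range T)) (f, p),
      forall g, op_dom T g -> exists2 p, op_comp S T (g, p) &
        orthogonal_projection (orthogonal_complement (op_ker T)) (g, p) &
      op_ker S = orthogonal_complement (op_range T)].

(* The reciprocal of T is only considered under this assumption. *)
Definition has_kernel_decomposition T :=
  op_dom T = subspace_sum (op_ker T)
    (op_dom T `&` orthogonal_complement (op_ker T)).

Lemma is_reciprocal_uniq T S S' : linear_operator T ->
  is_reciprocal T S -> is_reciprocal T S' -> S = S'.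
Proof.
move=> [_ T1].
suff sub A B : is_reciprocal T A -> is_reciprocal T B -> A `<=` B.
  by move=> hS hS'; apply/seteqP; split; apply: sub.
move=> [[[[A0 lA] A1] _] dA _ cA kA] [[[[B0 lB] B1] _] dB _ cB kB] [f g] Afg.
have : op_dom A f by exists g.
rewrite dA => -[u [h Thu] [v ov fE]].
have dTh : op_dom T h by exists u.
have [p [u1 /= Thu1 Aup] [Mp op]] := cA _ dTh.
have [q [u2 /= Thu2 Buq] [Mq oq]] := cB _ dTh.
have {u1 Thu1 Aup} Aup : A (u, p) by rewrite (T1 _ _ _ Thu Thu1).
have {u2 Thu2 Buq} Buq : B (u, q) by rewrite (T1 _ _ _ Thu Thu2).
have pq : p = q.
  apply/eqP; rewrite -subr_eq0; apply/eqP.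
  case: (eqVneq (p - q) 0) => // /(@neq0_dnorm_gt0 _ _ _ dot).
  suff -> : dot (p - q) (p - q) = 0 by rewrite ltxx.
  have Mpq : orthogonal_complement (op_ker T) (p - q).
    by move=> k kk; rewrite linearBl /= Mp// Mq// subrr.
  have e : h - q - (h - p) = p - q.
    by rewrite opprB addrCA addrAC subrr add0r addrC.
  by rewrite -{1}e linearBl /= op// oq// subrr.
have Av : A (v, 0) by rewrite -[A _]/(op_ker A v) kA.
have Bv : B (v, 0) by rewrite -[B _]/(op_ker B v) kB.
have fE' r : (u, r) + (v, 0) = (f, r) :> H * H.
  by rewrite -fE; congr (_, _); exact: addr0.
have Afp : A (f, p) by have := lA 1 _ _ Aup Av; rewrite scale1r fE'.
have Bfq : B (f, q) by have := lB 1 _ _ Buq Bv; rewrite scale1r fE'.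
by rewrite (A1 _ _ _ Afg Afp) pq.
Qed.

(* Outside the situation where it exists (and then is unique by
   is_reciprocal_uniq) the reciprocal has the junk value set0. *)
Definition reciprocal T : set (H * H) :=
  xget set0 [set S | has_kernel_decomposition T /\ is_reciprocal T S].

End operators.

(* R[i] carries no sigma-algebra in the library; Borel measurability of a
   complex function amounts to that of its real and imaginary parts. *)
Definition cmeasurable {d} {X : measurableType d} {R : realType}
    (f : X -> R[i]) :=
  measurable_fun setT (@complex.Re R \o f) /\
  measurable_fun setT (@complex.Im R \o f).

Section complex_integral.
Context {d} {X : measurableType d} {R : realType}.
Variable mu : {measure set X -> \bar R}.

Definition cintegrable (D : set X) (f : X -> R[i]) :=
  mu.-integrable D (EFin \o (@complex.Re R \o f)) /\
  mu.-integrable D (EFin \o (@complex.Im R \o f)).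

Definition cintegral (D : set X) (f : X -> R[i]) : R[i] :=
  Complex (\int[mu]_(x in D) complex.Re (f x))%R
          (\int[mu]_(x in D) complex.Im (f x))%R.

End complex_integral.

Section L2.
Context {d} {X : measurableType d} {R : realType}.
Variable mu : {measure set X -> \bar R}.
Implicit Types f g : X -> R[i].

Definition square_integrable : {pred X -> R[i]} := [pred f : X -> R[i] |
  `[< cmeasurable f /\ (\int[mu]_x ((normc (f x)) ^+ 2)%:E < +oo)%E >]].

Lemma sqr_normc (z : R[i]) :
  normc z ^+ 2 = complex.Re z ^+ 2 + complex.Im z ^+ 2.
Proof. by case: z => a b /=; rewrite sqr_sqrtr// addr_ge0// sqr_ge0. Qed.

Lemma ReM (a z : R[i]) : complex.Re (a * z) =
  complex.Re a * complex.Re z - complex.Im a * complex.Im z.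
Proof. by case: a z => [a b] [u v]. Qed.

Lemma ImM (a z : R[i]) : complex.Im (a * z) =
  complex.Re a * complex.Im z + complex.Im a * complex.Re z.
Proof. by case: a z => [a b] [u v]. Qed.

Lemma ReD (y z : R[i]) : complex.Re (y + z) = complex.Re y + complex.Re z.
Proof. by case: y z => [a b] [u v]. Qed.

Lemma ImD (y z : R[i]) : complex.Im (y + z) = complex.Im y + complex.Im z.
Proof. by case: y z => [a b] [u v]. Qed.

Lemma cmeasurableD f g : cmeasurable f -> cmeasurable g ->
  cmeasurable (f \+ g).
Proof.
move=> [f1 f2] [g1 g2]; split.
  rewrite (_ : _ \o _ = (@complex.Re R \o f) \+ (@complex.Re R \o g));
    last by apply/funext => x /=; rewrite ReD.
  exact: measurable_funD.
rewrite (_ : _ \o _ = (@complex.Im R \o f) \+ (@complex.Im R \o g));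
  last by apply/funext => x /=; rewrite ImD.
exact: measurable_funD.
Qed.

Lemma cmeasurableM f g : cmeasurable f -> cmeasurable g ->
  cmeasurable (f \* g).
Proof.
move=> [f1 f2] [g1 g2]; split.
  rewrite (_ : _ \o _ = ((@complex.Re R \o f) \* (@complex.Re R \o g)) \-
    ((@complex.Im R \o f) \* (@complex.Im R \o g)));
    last by apply/funext => x /=; rewrite ReM.
  by apply: measurable_funB; apply: measurable_funM.
rewrite (_ : _ \o _ = ((@complex.Re R \o f) \* (@complex.Im R \o g)) \+
    ((@complex.Im R \o f) \* (@complex.Re R \o g)));
    last by apply/funext => x /=; rewrite ImM.
by apply: measurable_funD; apply: measurable_funM.
Qed.

Lemma cmeasurable_cst (a : R[i]) : cmeasurable (cst a : X -> R[i]).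
Proof.
by split; [exact: (@measurable_cst _ _ X _ setT (complex.Re a))|
  exact: (@measurable_cst _ _ X _ setT (complex.Im a))].
Qed.

Lemma cmeasurable_conj f : cmeasurable f -> cmeasurable (fun x => (f x)^*).
Proof.
move=> [f1 f2]; split.
  by rewrite (_ : _ \o _ = @complex.Re R \o f)//; apply/funext => x /=; case: (f x).
rewrite (_ : _ \o _ = \- (@complex.Im R \o f)).
  exact: measurableT_comp.
by apply/funext => x /=; case: (f x).
Qed.

Lemma measurable_sqr_normc f : cmeasurable f ->
  measurable_fun setT (fun x => normc (f x) ^+ 2).
Proof.
move=> [f1 f2]; rewrite (_ : (fun _ => _) =
  ((@complex.Re R \o f) \* (@complex.Re R \o f)) \+
  ((@complex.Im R \o f) \* (@complex.Im R \o f))); last first.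
  by apply/funext => x /=; rewrite sqr_normc.
by apply: measurable_funD; apply: measurable_funM.
Qed.

Lemma square_integrableP f :
  reflect (cmeasurable f /\ mu.-integrable setT (fun x => (normc (f x) ^+ 2)%:E))
    (f \in square_integrable).
Proof.
apply: (iffP (asboolP _)) => -[mf fi]; split => //.
  apply/integrableP; split.
    by apply/measurable_EFinP; exact: measurable_sqr_normc.
  by under eq_integral do rewrite gee0_abs ?lee_fin ?sqr_ge0//.
move/integrableP : fi => [_].
by under eq_integral do rewrite gee0_abs ?lee_fin ?sqr_ge0//.
Qed.

Lemma square_integrable_submod_closed : submod_closed square_integrable.
Proof.
split.
  apply/square_integrableP; split; first exact: cmeasurable_cst.
  apply: (eq_integrable _ (cst 0%E)) => //; last exact: integrable0.
  by move=> x _ /=; rewrite expr0n addr0 sqrtr0 expr0n.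
move=> a f g /square_integrableP[mf fi] /square_integrableP[mg gi].
have mafg : cmeasurable (a *: f + g).
  apply: (@cmeasurableD (a *: f)) => //.
  by apply: (@cmeasurableM (cst a)) => //; exact: cmeasurable_cst.
apply/square_integrableP; split => //.
apply: (@le_integrable _ _ _ mu setT measurableT _
  (fun x => (2 * normc a ^+ 2)%:E * (normc (f x) ^+ 2)%:E +
            2%:E * (normc (g x) ^+ 2)%:E)%E).
- by apply/measurable_EFinP; exact: measurable_sqr_normc.
- move=> x _; rewrite -!EFinM -EFinD !abse_EFin lee_fin.
  have g0 : 0 <= 2 * normc a ^+ 2 * normc (f x) ^+ 2 + 2 * normc (g x) ^+ 2.
    by apply: addr_ge0; do ?[exact: sqr_ge0|exact: ler0n|apply: mulr_ge0].
  rewrite (ger0_norm g0) ger0_norm ?sqr_ge0//.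
  rewrite (_ : (a *: f + g) x = a * f x + g x)// !sqr_normc ReD ImD ReM ImM.
  move: (complex.Re a) (complex.Im a) (complex.Re (f x)) (complex.Im (f x)).
  move: (complex.Re (g x)) (complex.Im (g x)) => u v p q r s.
  have h1 := sqr_ge0 (p * r - q * s - u).
  have h2 := sqr_ge0 (p * s + q * r - v).
  rewrite -subr_ge0; set L := (X in 0 <= X).
  have -> : L = (p * r - q * s - u) ^+ 2 + (p * s + q * r - v) ^+ 2.
    by rewrite /L; ring.
  exact: addr_ge0.
- by apply: integrableD => //; exact: integrableZl.
Qed.

HB.instance Definition _ := GRing.isSubmodClosed.Build R[i] (X -> R[i])
  square_integrable square_integrable_submod_closed.

Record L2fun : Type := MkL2fun {
  L2fun_val :> X -> R[i] ;
  L2fun_valP : L2fun_val \in square_integrable }.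

HB.instance Definition _ := [isSub for L2fun_val].
HB.instance Definition _ := [Choice of L2fun by <:].
HB.instance Definition _ := [SubChoice_isSubLmodule of L2fun by <:].

Definition L2null : {pred L2fun} :=
  [pred f : L2fun | `[< {ae mu, forall x, f x = 0} >]].

Lemma L2null_submod_closed : submod_closed L2null.
Proof.
split; first by apply/asboolP; apply: aeW.
move=> a f g /asboolP f0 /asboolP g0; apply/asboolP.
apply: filterS2 f0 g0 => x fx gx.
by rewrite (_ : _ x = a * f x + g x)// fx gx mulr0 addr0.
Qed.

HB.instance Definition _ := GRing.isSubmodClosed.Build R[i] L2fun
  L2null L2null_submod_closed.

Definition L2 : Type := Quotient.quot L2null.

HB.instance Definition _ := GRing.Zmodule.on L2.
HB.instance Definition _ := EqQuotient.on L2.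

Definition L2_fun (u : L2) : X -> R[i] := repr u.
Coercion L2_fun : L2 >-> Funclass.

Lemma L2_piP (f g : L2fun) :
  \pi_L2 f = \pi_L2 g <-> {ae mu, forall x, f x = g x}.
Proof.
have E : (\pi_L2 f = \pi_L2 g) <-> (f - g \in L2null).
  by rewrite Quotient.idealrBE; split => [->//|/eqP].
rewrite E; split => [/asboolP fg|fg].
  by apply: filterS fg => x /eqP; rewrite -[X in X == _]/(f x - g x) subr_eq0 => /eqP.
apply/asboolP; apply: filterS fg => x fg.
by rewrite -[LHS]/(f x - g x) fg subrr.
Qed.

Lemma L2P (u v : L2) : u = v <-> {ae mu, forall x, u x = v x}.
Proof. by rewrite -L2_piP !reprK. Qed.

Lemma L2_piE (f : L2fun) : {ae mu, forall x, (\pi_L2 f : L2) x = f x}.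
Proof. by apply/L2_piP; rewrite reprK. Qed.

Lemma L2DE (u v : L2) : {ae mu, forall x, (u + v : L2) x = u x + v x}.
Proof.
have -> : u + v = \pi_L2 (repr u + repr v) by rewrite raddfD /= !reprK.
exact: L2_piE.
Qed.

Definition L2scale (a : R[i]) (u : L2) : L2 := \pi_L2 (a *: (repr u : L2fun)).

Lemma L2scaleE a (u : L2) : {ae mu, forall x, L2scale a u x = a * u x}.
Proof. exact: L2_piE. Qed.

Lemma L2scaleA a b u : L2scale a (L2scale b u) = L2scale (a * b) u.
Proof.
apply/L2P.
apply: filterS3 (L2scaleE a (L2scale b u)) (L2scaleE b u) (L2scaleE (a * b) u).
by move=> x -> -> ->; rewrite mulrA.
Qed.

Lemma L2scale1 : left_id 1 L2scale.
Proof. by move=> u; rewrite /L2scale scale1r reprK. Qed.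

Lemma L2scaleDr : right_distributive L2scale +%R.
Proof.
move=> a u v; apply/L2P.
near=> x.
have -> : L2scale a (u + v) x = a * (u + v : L2) x by near: x; exact: L2scaleE.
have -> : (u + v : L2) x = u x + v x by near: x; exact: L2DE.
have -> : (L2scale a u + L2scale a v : L2) x = L2scale a u x + L2scale a v x.
  by near: x; exact: L2DE.
have -> : L2scale a u x = a * u x by near: x; exact: L2scaleE.
have -> : L2scale a v x = a * v x by near: x; exact: L2scaleE.
by rewrite mulrDr.
Unshelve. all: by end_near.
Qed.

Lemma L2scaleDl u : {morph L2scale^~ u : a b / a + b}.
Proof. by move=> a b; rewrite /L2scale scalerDl raddfD. Qed.

HB.instance Definition _ := GRing.Zmodule_isLmodule.Build R[i] L2
  L2scaleA L2scale1 L2scaleDr L2scaleDl.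

Definition L2dot (u v : L2) : R[i] :=
  cintegral mu setT (fun x => u x * (v x)^*).

Lemma L2_square_integrable (u : L2) : (u : X -> R[i]) \in square_integrable.
Proof. exact: L2fun_valP. Qed.

Lemma cmeasurable_L2 (u : L2) : cmeasurable u.
Proof. by have /square_integrableP[] := L2_square_integrable u. Qed.

Lemma ler_norm_sum4 (a b p q s : R) : (s = a * p + b * q) ->
  `|s| <= a ^+ 2 + b ^+ 2 + (p ^+ 2 + q ^+ 2).
Proof.
move=> ->; have := (sqr_ge0 (a + p), sqr_ge0 (a - p), sqr_ge0 (b + q), sqr_ge0 (b - q)).
move=> [[[h1 h2] h3] h4]; rewrite ler_norml; apply/andP; split; nra.
Qed.

Lemma cintegrable_L2dot (u v : L2) :
  cintegrable mu setT (fun x => u x * (v x)^*).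
Proof.
have /square_integrableP[mu_ iu] := L2_square_integrable u.
have /square_integrableP[mv iv] := L2_square_integrable v.
have [m1 m2] := cmeasurableM mu_ (cmeasurable_conj mv).
split.
- apply: (le_integrable _ _ _ (integrableD measurableT iu iv)) => //.
    exact/measurable_EFinP.
  move=> x _; rewrite -EFinD !abse_EFin lee_fin [leRHS]ger0_norm; last first.
    by apply: addr_ge0; exact: sqr_ge0.
  rewrite /= !sqr_normc; case: (u x) (v x) => [a b] [p q] /=.
  by apply: ler_norm_sum4; ring.
- apply: (le_integrable _ _ _ (integrableD measurableT iu iv)) => //.
    exact/measurable_EFinP.
  move=> x _; rewrite -EFinD !abse_EFin lee_fin [leRHS]ger0_norm; last first.
    by apply: addr_ge0; exact: sqr_ge0.
  rewrite /= !sqr_normc; case: (u x) (v x) => [a b] [p q] /=.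
  by rewrite [X in _ <= _ + X]addrC -(sqrrN q); apply: ler_norm_sum4; ring.
Qed.

Lemma cintegral_ae_eq (f g : X -> R[i]) : cmeasurable f -> cmeasurable g ->
  {ae mu, forall x, f x = g x} -> cintegral mu setT f = cintegral mu setT g.
Proof.
move=> [f1 f2] [g1 g2] fg; congr Complex; congr fine.
- apply: ae_eq_integral => //; [exact/measurable_EFinP|exact/measurable_EFinP|].
  by apply: filterS fg => x -> _.
- apply: ae_eq_integral => //; [exact/measurable_EFinP|exact/measurable_EFinP|].
  by apply: filterS fg => x -> _.
Qed.

Lemma cintegralD (f g : X -> R[i]) :
  cintegrable mu setT f -> cintegrable mu setT g ->
  cintegral mu setT (f \+ g) = cintegral mu setT f + cintegral mu setT g.
Proof.
move=> [f1 f2] [g1 g2]; rewrite /cintegral.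
apply/eqP; rewrite eq_complex ReD ImD /= -!RintegralD//.
by apply/andP; split; apply/eqP/eq_Rintegral => x _ /=; rewrite ?ReD ?ImD.
Qed.

Lemma integrable_EFinZ (r : R) (h : X -> R) :
  mu.-integrable setT (EFin \o h) ->
  mu.-integrable setT (EFin \o (fun x => r * h x)).
Proof.
move=> ih; have := integrableZl measurableT r ih.
by apply: eq_integrable.
Qed.

Lemma cintegrableZ a (f : X -> R[i]) : cintegrable mu setT f ->
  cintegrable mu setT (fun x => a * f x).
Proof.
move=> [f1 f2]; have Z := integrable_EFinZ.
split.
  have := integrableB measurableT (Z (complex.Re a) _ f1) (Z (complex.Im a) _ f2).
  by apply: eq_integrable => // x _ /=; rewrite ReM.
have := integrableD measurableT (Z (complex.Re a) _ f2) (Z (complex.Im a) _ f1).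
by apply: eq_integrable => // x _ /=; rewrite ImM.
Qed.

Lemma cintegralZ a (f : X -> R[i]) : cintegrable mu setT f ->
  cintegral mu setT (fun x => a * f x) = a * cintegral mu setT f.
Proof.
move=> [f1 f2]; rewrite /cintegral; have Z := integrable_EFinZ.
apply/eqP; rewrite eq_complex ReM ImM /= -!RintegralZl//.
rewrite -RintegralB//; [|exact: Z|exact: Z].
rewrite -RintegralD//; [|exact: Z|exact: Z].
by apply/andP; split; apply/eqP/eq_Rintegral => x _ /=; rewrite ?ReM ?ImM.
Qed.

Lemma L2dot_linearl (v : L2) : GRing.linear_for *%R (L2dot^~ v).
Proof.
move=> a u w; rewrite /L2dot -cintegralZ; last exact: cintegrable_L2dot.
have mc (z : L2) := cmeasurableM (cmeasurable_L2 z) (cmeasurable_conj (cmeasurable_L2 v)).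
have [iau iw] : cintegrable mu setT (fun x => a * (L2_fun u x * (v x)^*)) /\
    cintegrable mu setT (fun x => L2_fun w x * (v x)^*).
  by split; [exact: cintegrableZ (cintegrable_L2dot _ _)|exact: cintegrable_L2dot].
rewrite -cintegralD//; apply: cintegral_ae_eq => //.
    exact: mc.
  apply: cmeasurableD; last exact: mc.
  by apply: (@cmeasurableM (cst a)); [exact: cmeasurable_cst|exact: mc].
apply: filterS2 (L2DE (a *: u) w) (L2scaleE a u) => x -> /= E.
by rewrite [L2_fun (_ *: _) x]E mulrDl mulrA.
Qed.

Lemma L2dot_hermitian (u v : L2) : L2dot u v = (-1) ^+ false * (L2dot v u)^*.
Proof.
have [_ i2] := cintegrable_L2dot v u.
rewrite expr0 mul1r /L2dot /cintegral; apply/eqP; rewrite eq_complex /=.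
rewrite -mulN1r -RintegralZl//; apply/andP; split; apply/eqP/eq_Rintegral => x _.
  by case: (u x) (v x) => [a b] [p q] /=; ring.
by case: (u x) (v x) => [a b] [p q] /=; ring.
Qed.

Lemma L2dot_linearr (u : L2) : GRing.linear_for (conjC \; *%R) (L2dot u).
Proof.
move=> a v w; rewrite L2dot_hermitian (L2dot_linearl u) [in RHS]L2dot_hermitian.
rewrite [L2dot u w]L2dot_hermitian !expr0 !mul1r.
by rewrite rmorphD rmorphM.
Qed.

Lemma L2dot_gt0 (u : L2) : u != 0 -> 0 < L2dot u u.
Proof.
move=> u0.
have /square_integrableP[m_u iu] := L2_square_integrable u.
have -> : L2dot u u = (\int[mu]_x (normc (u x) ^+ 2))%R%:C%C.
  apply/eqP; rewrite eq_complex /=; apply/andP; split; apply/eqP.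
    by apply: eq_Rintegral => x _; rewrite sqr_normc; case: (u x) => a b /=; ring.
  have -> : (fun x => complex.Im (u x * (u x)^*)) = cst 0.
    by apply/funext => x /=; case: (u x) => a b /=; ring.
  by rewrite Rintegral_cst// mul0r.
rewrite ltcR lt_def Rintegral_ge0 ?andbT; last by move=> x _; exact: sqr_ge0.
apply: contra u0 => /eqP I0; apply/eqP/L2P.
have I1 : (\int[mu]_x `|(normc (u x) ^+ 2)%:E| = 0)%E.
  under eq_integral do rewrite gee0_abs ?lee_fin ?sqr_ge0//.
  by rewrite -[LHS]fineK ?integrable_fin_num// [X in X%:E]I0.
have m2 : measurable_fun setT (fun x => (normc (u x) ^+ 2)%:E).
  by apply/measurable_EFinP; exact: measurable_sqr_normc.
have h := (ae_eq_integral_abs mu measurableT m2).1 I1.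
have Z : {ae mu, forall x, (0 : L2) x = 0}.
  by have := L2_piE (0 : L2fun); rewrite raddf0; apply: filterS => x ->.
apply: filterS2 h Z => x /= /(_ Logic.I) [/eqP] + ->.
by rewrite sqrf_eq0 => /eqP/eq0_normc.
Qed.

HB.instance Definition _ := bilinear_isBilinear.Build R[i] L2 L2 R[i]
  *%R (conjC \; *%R) L2dot (L2dot_linearl, L2dot_linearr).
HB.instance Definition _ := isHermitianSesquilinear.Build R[i] L2 false conjC
  L2dot L2dot_hermitian.
HB.instance Definition _ := isDotProduct.Build R[i] L2 L2dot L2dot_gt0.

End L2.

Arguments L2 {d X R} mu.
Arguments L2dot {d X R} mu.

Section weighted_composition.
Context {d} {X : measurableType d} {R : realType}.
Variable mu : {measure set X -> \bar R}.
Implicit Types (phi : X -> X) (w : X -> R[i]).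

Definition weighted_measure w (A : set X) : \bar R :=
  (\int[mu]_(x in A) ((normc (w x)) ^+ 2)%:E)%E.

Definition wcomp_well_defined phi w :=
  pushforward (weighted_measure w) phi `<< mu.

(* Graph of f |-> w * (f \o phi). That some g in L^2 agrees a.e. with
   w * (f \o phi) is the membership of the latter in L^2. *)
Definition wcomp phi w : set (L2 mu * L2 mu) :=
  [set fg : L2 mu * L2 mu | {ae mu, forall x, fg.2 x = w x * fg.1 (phi x)}].

Definition wcomp_densely_defined phi w :=
  wcomp_well_defined phi w /\ norm_dense (L2dot mu) (op_dom (wcomp phi w)).

Definition comp_densely_defined phi := wcomp_densely_defined phi (cst 1).

(* The functions below are determined up to null sets by the properties in
   the set-builders; xget selects a version. *)

Definition hderiv phi : X -> \bar R := xget (cst 0%E) [set h |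
  [/\ measurable_fun setT h, forall x, (0 <= h x)%E &
      forall A, measurable A -> mu (phi @^-1` A) = (\int[mu]_(x in A) h x)%E]].

Definition condexp_ge0 phi (f : X -> \bar R) : X -> \bar R :=
  xget (cst 0%E) [set F : X -> \bar R |
    [/\ measurable_fun setT (F : g_sigma_algebra_preimageType phi -> \bar R),
        forall x, (0 <= F x)%E &
        forall A, measurable A ->
          (\int[mu]_(x in phi @^-1` A) F x)%E =
          (\int[mu]_(x in phi @^-1` A) f x)%E]].

(* An element of L^p is integrable only over sets of finite measure, whence
   the restriction on A; it still determines the conditional expectation
   because mu is sigma-finite on the preimage sigma-algebra as soon as
   C_phi is densely defined. *)
Definition condexp phi (f : X -> R[i]) : X -> R[i] :=
  xget (cst 0) [set F : X -> R[i] |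
    cmeasurable (F : g_sigma_algebra_preimageType phi -> R[i]) /\
    forall A, measurable A -> (mu (phi @^-1` A) < +oo)%E ->
      cintegrable mu (phi @^-1` A) F /\
      cintegral mu (phi @^-1` A) F = cintegral mu (phi @^-1` A) f].

Definition condexp_ge0_inv phi (f : X -> \bar R) : X -> \bar R :=
  xget (cst 0%E) [set g : X -> \bar R |
    [/\ measurable_fun setT g,
        {ae mu, forall x, hderiv phi x = 0%E -> g x = 0%E} &
        {ae mu, forall x, condexp_ge0 phi f x = g (phi x)}]].

Definition condexp_inv phi (f : X -> R[i]) : X -> R[i] :=
  xget (cst 0) [set g : X -> R[i] |
    [/\ cmeasurable g,
        {ae mu, forall x, hderiv phi x = 0%E -> g x = 0} &
        {ae mu, forall x, condexp phi f x = g (phi x)}]].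

(* Division with 1/0 = oo and 0 * oo = 0, where None stands for oo. For
   y = +oo the value is 0, since fine +oo = 0 and 0^-1 = 0. *)
Definition cdive (z : R[i]) (y : \bar R) : option R[i] :=
  if y == 0%E then (if z == 0 then Some 0 else None)
  else Some (z * ((fine y)^-1)%:C%C).

Definition reciprocal_formula phi w (f : X -> R[i]) : X -> option R[i] :=
  fun x => cdive (condexp_inv phi (fun y => f y * (w y)^*) x)
    (condexp_ge0_inv phi (fun y => ((normc (w y)) ^+ 2)%:E) x).

Definition in_L2 (q : X -> option R[i]) :=
  exists g : L2 mu, {ae mu, forall x, q x = Some (g x)}.

End weighted_composition.

Arguments wcomp {d X R} mu phi w.

(* Main.v *)
From HB Require Import structures.
From mathcomp Require Import all_boot all_order all_algebra.
From mathcomp Require Import all_classical all_reals all_analysis.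
From mathcomp Require Import complex sesquilinear measurable_realfun.
From mathcomp Require Import ring lra.
Require Import Defs.

Set Implicit Arguments.
Unset Strict Implicit.
Unset Printing Implicit Defensive.

Import Order.TTheory GRing.Theory Num.Theory Num.Def.
Import Defs.
Local Open Scope ring_scope.
Local Open Scope classical_set_scope.

(** Write T for the operator sending f to w (f o phi), and nu for the image of
mu under phi.

For a function r, the set function sending A to the integral of r over
phi^-1(A) has a density s with respect to mu, characterised by the equality of
the integrals of r (g o phi) and of s g for all test functions g
([pushforward_density], [complex_density]). Let h, sw and s be the densities
obtained from r = 1, r = |w|^2 and r = f conj(w). Conditional expectations
given phi are quotients of such densities: transported to X, those of |w|^2
and of f conj(w) are sw / h and s / h where h <> 0, and both vanish elsewhere.
The quotient in the theorem is therefore u = s / sw, with value 0 where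
sw = 0 ([reciprocal_formulaE]).

It remains to identify u with the value of the reciprocal at f. A pair (f, g)
belongs to the reciprocal of T if and only if g is orthogonal to the kernel of
T and f - T g is orthogonal to its range ([reciprocal_moore_penrose]). For the
operator at hand |T g|^2 is the integral of sw |g|^2, so that the kernel
consists of the functions vanishing where sw <> 0, and the inner product of f
with T g is the integral of s conj(g) = sw u conj(g). This is formally the
inner product of T u with T g: hence f - w (u o phi) is orthogonal to the
range of T, provided that w (u o phi) is square integrable. It always is, even
if u is not: with u_n a truncation of u, f - T u_n is orthogonal to T u_n, so
that |T u_n| <= |f|, and monotone convergence concludes ([dagger_in_L2]).
Since T u_n converges to w (u o phi), this function is the orthogonal
projection of f onto the closure of the range of T, and f is in the domain of
the reciprocal exactly when u is in L^2, in which case u is the value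
([moore_penrose_dagger]).

The densities exist because nu is sigma-finite, which follows from the density
of the domain of the composition operator ([comp_exhaustion]), and because the
bound on w makes |w|^2 and f conj(w) integrable over every preimage of finite
measure. That w does not vanish ensures that s = 0 almost everywhere on the
set where sw = 0 ([density_null]). *)

(** * Measurability *)

Lemma measurable_preimage {d d'} {X : measurableType d} {Y : measurableType d'}
    (phi : X -> Y) (A : set Y) :
  measurable_fun setT phi -> measurable A -> measurable (phi @^-1` A).
Proof. by move=> mphi mA; rewrite -[_ @^-1` _]setTI; exact: mphi. Qed.

Lemma measurable_ler_set {d} {X : measurableType d} {R : realType} (f g : X -> R) :
  measurable_fun setT f -> measurable_fun setT g ->
  measurable [set x | f x <= g x].
Proof.
move=> mf mg; rewrite -[X in measurable X]setTI.
rewrite (_ : [set x | _] = [set x | ((f x)%:E <= (g x)%:E)%E]); last first.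
  by apply/funext => x; rewrite /= lee_fin.
by apply: measurable_lee => //; exact/measurable_EFinP.
Qed.

Lemma measurable_eqr_set {d} {X : measurableType d} {R : realType} (f g : X -> R) :
  measurable_fun setT f -> measurable_fun setT g ->
  measurable [set x | f x = g x].
Proof.
move=> mf mg; rewrite (_ : [set x | _] =
  [set x | f x <= g x] `&` [set x | g x <= f x]).
  by apply: measurableI; exact: measurable_ler_set.
apply/seteqP; split => x /=; first by move=> ->.
by case=> fg gf; apply/eqP; rewrite eq_le fg gf.
Qed.

(** The total inverse, with 1 / 0 = 0, is on nonnegative reals the power
function of exponent -1. *)
Lemma measurable_inv_ge0 {d} {X : measurableType d} {R : realType} (f : X -> R) :
  measurable_fun setT f -> (forall x, 0 <= f x) ->
  measurable_fun setT (fun x => (f x)^-1).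
Proof.
move=> mf f0; rewrite (_ : (fun x => _) = (fun r => r `^ (-1)) \o f).
  by apply: measurableT_comp => //; exact: measurable_powR.
by apply/funext => x /=; rewrite powR_inv1.
Qed.

(** * Reciprocals as Moore-Penrose inverses *)

Section abstract_reciprocal.
Context {C : numClosedFieldType} {H : lmodType C}.
Variable dot : {dot H for (@conjC C : C -> C)}.
Implicit Types (M : set H) (T : set (H * H)).
Local Notation perp := (orthogonal_complement dot).

Lemma dotC (u v : H) : dot u v = (dot v u)^*.
Proof. by rewrite (hermC dot) /= expr0 mul1r. Qed.

Lemma orthocompC M u v : perp M u -> M v -> dot v u = 0.
Proof. by move=> Mu Mv; rewrite dotC Mu// rmorph0. Qed.

Lemma orthocomp_linear M : linear_subspace (perp M).
Proof.
split=> [m _|a u v Mu Mv m Mm]; first by rewrite linear0l.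
by rewrite linearDl/= linearZl_LR/= Mu// Mv// mulr0 addr0.
Qed.

Lemma orthocompB M u v : perp M u -> perp M v -> perp M (u - v).
Proof. by move=> Mu Mv m Mm; rewrite linearBl/= Mu// Mv// subrr. Qed.

Lemma orthocomp_self M u : M u -> perp M u -> u = 0.
Proof.
move=> Mu Nu; apply/eqP; case: (eqVneq u 0) => // /(@neq0_dnorm_gt0 _ _ _ dot).
by rewrite Nu// ltxx.
Qed.

Lemma sub_norm_closure M : M `<=` norm_closure dot M.
Proof. by move=> m Mm e e0; exists m => //; rewrite subrr linear0l exprn_gt0. Qed.

(** With a the inner product of v and m, and x = m - g for some g in M,
expanding the square of the norm of x - t conj(a) v for t = 1 / (|v|^2 + 1)
gives t |a|^2 <= |x|^2. When a <> 0, this is false for g close enough to m. *)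
Lemma orthocomp_closure M v : perp M v -> perp (norm_closure dot M) v.
Proof.
move=> Mv m clm; apply/eqP; apply: contraT => a0; set a := dot v m in a0.
pose t := (dot v v + 1)^-1.
have t0 : 0 < t by rewrite invr_gt0 ltr_wpDl// dnorm_ge0.
have tr : t^* = t by apply/CrealP/ger0_real/ltW.
have [] := clm (sqrtC t * `|a|); first by rewrite mulr_gt0 ?sqrtC_gt0 ?normr_gt0.
move=> g Mg; have : dot v (m - g) = a by rewrite linearBr/= (Mv _ Mg) subr0.
move: (m - g) => x vx; rewrite exprMn sqrtCK normCK => lt_x.
have := dnorm_ge0 dot (x - (t * a^*) *: v).
have xv : dot x ((t * a^*) *: v) = t * (a * a^*).
  by rewrite dotC linearZl_LR/= vx !rmorphM/= conjCK tr mulrA.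
have vv : dot v ((t * a^*) *: v) = t * a * dot v v.
  by rewrite dotC linearZl_LR/= !rmorphM/= conjCK tr -dotC.
rewrite linearBl 2!linearBr/= !linearZl_LR/= vx xv vv => ge0_x.
have tv : t * dot v v <= 1.
  by rewrite mulrC ler_pdivrMr ?ltr_wpDl ?dnorm_ge0// mul1r lerDl ler01.
have aa : 0 <= t * (a * a^*) by rewrite mulr_ge0 ?mul_conjC_ge0 ?ltW.
have h3 : t * (a * a^*) * (t * dot v v) <= t * (a * a^*) by rewrite ler_piMr.
have : dot x x - t * (a * a^*) + (t * (a * a^*) * (t * dot v v) - t * (a * a^*)) < 0.
  by rewrite -[ltRHS]addr0 ltr_leD// ?subr_lt0// subr_le0.
move/lt_geF => <-; move: ge0_x; congr (_ <= _).
by rewrite /GRing.scale/=; ring.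
Qed.

(** T g is the orthogonal projection of f onto the range of T, and g is the
preimage of this projection that has the least norm. *)
Definition moore_penrose T : set (H * H) :=
  [set fg | perp (op_ker T) fg.2 /\
    exists2 p, T (fg.2, p) & perp (op_range T) (fg.1 - p)].

Lemma op_range_linear T : linear_operator T -> linear_subspace (op_range T).
Proof.
move=> [[T0 lT] _]; split; first by exists 0.
by move=> a u v [f Tfu] [g Tgv]; exists (a *: f + g); apply: lT Tfu Tgv.
Qed.

Lemma op_rangeB T u v : linear_operator T ->
  op_range T u -> op_range T v -> op_range T (u - v).
Proof.
move=> /op_range_linear[_ lT] Tu Tv.
by rewrite addrC -scaleN1r; exact: lT.
Qed.

Lemma op_kerB T f g p : linear_operator T ->
  T (f, p) -> T (g, p) -> op_ker T (f - g).
Proof.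
move=> [[_ lT] _] Tf Tg; have := lT (-1) _ _ Tg Tf.
by rewrite /op_ker /= /GRing.scale/= /GRing.add/= /add_pair/= !scaleN1r addNr addrC.
Qed.

(** Every value of T is attained at a vector orthogonal to the kernel: remove
from g its kernel component. *)
Lemma kernel_reduction T g p : linear_operator T ->
  has_kernel_decomposition dot T -> T (g, p) ->
  exists2 h, T (h, p) & perp (op_ker T) h /\ op_ker T (g - h).
Proof.
move=> lT dT Tgp; have : op_dom T g by exists p.
rewrite dT => -[k kk [h [[q Thq] ph] khg]]; have gh : g - h = k by rewrite -khg addrK.
exists h; last by rewrite gh.
have [[_ sT] _] := lT; have := sT (-1) _ _ kk Tgp.
congr T; congr pair => /=; last by rewrite scaler0 add0r.
by rewrite scaleN1r -gh opprB subrK.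
Qed.

Lemma moore_penrose_dom T : linear_operator T ->
  has_kernel_decomposition dot T ->
  op_dom (moore_penrose T) =
    subspace_sum (op_range T) (perp (op_range T)).
Proof.
move=> lT dT; apply/seteqP; split=> [f [g [_ /= [p Tp fp]]]|_ [p [g Tgp] [v pv <-]]].
  by exists p; [exists g|exists (f - p) => //; rewrite addrC subrK].
have [h Thp [ph _]] := kernel_reduction lT dT Tgp.
exists h; split=> //=; exists p => //.
by rewrite addrC addrA addNr add0r.
Qed.

(** Two candidates T g and T g' for the projection of f differ by a vector
that is both in the range and orthogonal to it, so they agree; then g and g'
differ by a vector that is both in the kernel and orthogonal to it. *)
Lemma moore_penroseP T : linear_operator T ->
  has_kernel_decomposition dot T ->
  norm_dense dot (subspace_sum (op_range T) (perp (op_range T))) ->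
  is_reciprocal dot T (moore_penrose T).
Proof.
move=> lT dT den; have domE := moore_penrose_dom lT dT.
have [[T0 sT] fT] := lT.
split => //; [split=> //; [split|by rewrite domE]|..].
- split=> [|a u v [Nu [p Tp up]] [Nv [q Tq vq]]].
    split; first by case: (orthocomp_linear (op_ker T)).
    by exists 0 => //=; rewrite subr0; case: (orthocomp_linear (op_range T)).
  split; first by case: (orthocomp_linear (op_ker T)) => _; apply.
  exists (a *: p + q) => /=; first exact: sT Tp Tq.
  have -> : a *: u.1 + v.1 - (a *: p + q) = a *: (u.1 - p) + (v.1 - q).
    by rewrite scalerBr opprD addrACA.
  by case: (orthocomp_linear (op_range T)) => _; apply.
- move=> f g g' [/= Ng [p Tp fp]] [/= Ng' [q Tq fq]].
  have pq : p = q.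
    apply/eqP; rewrite -subr_eq0; apply/eqP; apply: (@orthocomp_self (op_range T)).
      by apply: op_rangeB lT _ _; [exists g|exists g'].
    have -> : p - q = (f - q) - (f - p) by rewrite opprB [RHS]addrC addrA subrK.
    exact: orthocompB.
  apply/eqP; rewrite -subr_eq0; apply/eqP; apply: (@orthocomp_self (op_ker T)).
    by apply: op_kerB lT Tp _; rewrite pq.
  exact: orthocompB.
- move=> f [g [/= Ng [p Tp fp]]]; exists p; first by exists g => //; split=> //; exists p.
  split=> /=; first by apply: sub_norm_closure; exists g.
  exact: orthocomp_closure.
- move=> g [p Tgp]; have [h Thp [ph kgh]] := kernel_reduction lT dT Tgp.
  exists h => /=.
    exists p => //; split=> //=; exists p => //=.
    by rewrite subrr; case: (orthocomp_linear (op_range T)).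
  by split=> //= m pm; exact: orthocompC pm kgh.
- apply/seteqP; split=> f.
    move=> [_ /= [p Tp fp]]; suff p0 : p = 0 by rewrite p0 subr0 in fp.
    exact: fT Tp T0.
  move=> fp; split; first by case: (orthocomp_linear (op_ker T)).
  by exists 0 => //=; rewrite subr0.
Qed.

Lemma reciprocal_moore_penrose T : linear_operator T ->
  has_kernel_decomposition dot T ->
  norm_dense dot (subspace_sum (op_range T) (perp (op_range T))) ->
  reciprocal dot T = moore_penrose T.
Proof.
move=> lT dT den; have mp := moore_penroseP lT dT den.
apply: (is_reciprocal_uniq lT _ mp).
rewrite /reciprocal; set P := (P in xget _ P).
have [_ rT] : P (xget set0 P) by apply: xgetPex; exists (moore_penrose T).
exact: rT.
Qed.
End abstract_reciprocal.

(** * Densities of measures transported by a map *)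

Section pushforward_density.
Local Open Scope ereal_scope.
Context {d d'} {X : measurableType d} {Y : measurableType d'} {R : realType}.
Variables (mu : {measure set X -> \bar R}) (la : {measure set Y -> \bar R}).
Variable (phi : X -> Y).
Hypothesis mphi : measurable_fun setT phi.
Implicit Types (r : X -> R) (s : Y -> R).

(** s is the density with respect to la of the image under phi of the measure
r mu. The definition quantifies over test functions because all later uses
integrate such functions; sets are enough by [pushforward_densityP]. *)
Definition pushforward_density r s := [/\ measurable_fun setT s,
  forall y, (0 <= s y)%R &
  forall g : Y -> \bar R, measurable_fun setT g -> (forall y, 0 <= g y) ->
    \int[mu]_x ((r x)%:E * g (phi x)) = \int[la]_y ((s y)%:E * g y)].

Import HBNNSimple.

(** The expansion E of the integral of a simple function along its level sets
serves for both sides, the right-hand side being the case of the identity map. *)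
Lemma pushforward_density_nnsfun r s (h : {nnsfun Y >-> R}) :
  measurable_fun setT r -> (forall x, (0 <= r x)%R) ->
  measurable_fun setT s -> (forall y, (0 <= s y)%R) ->
  (forall A, measurable A ->
    \int[mu]_(x in phi @^-1` A) (r x)%:E = \int[la]_(y in A) (s y)%:E) ->
  \int[mu]_x ((r x)%:E * (h (phi x))%:E) = \int[la]_y ((s y)%:E * (h y)%:E).
Proof.
move=> mr r0 ms s0 rs.
have mind B : measurable B -> measurable_fun setT (EFin \o \1_B : Y -> _).
  by move=> mB; apply/measurable_EFinP.
pose A a := h @^-1` [set a].
have mA a : measurable (A a) by exact: measurable_funPTI.
have E dd (T : measurableType dd) (m : {measure set T -> \bar R}) (q : T -> R)
    (p : T -> Y) : measurable_fun setT p -> measurable_fun setT q ->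
    (forall x, (0 <= q x)%R) ->
    \int[m]_x ((q x)%:E * (h (p x))%:E) =
    \sum_(a \in range h) a%:E * \int[m]_(x in p @^-1` A a) (q x)%:E.
  move=> mp mq q0.
  have mpA a : measurable (p @^-1` A a).
    exact: measurable_preimage mp _.
  transitivity (\int[m]_x (\sum_(a \in range h)
      (a%:E * ((q x)%:E * (\1_(p @^-1` A a) x)%:E)))).
    apply: eq_integral => x _; rewrite [in LHS]fimfunE -fsumEFin//.
    rewrite ge0_mule_fsumr; last by move=> a; exact: nnfun_muleindic_ge0.
    apply: eq_fsbigr => a _; rewrite EFinM muleCA; congr (_ * (_ * _)).
  have mi a : measurable_fun setT (fun x => (q x)%:E * (\1_(p @^-1` A a) x)%:E).
    by apply: emeasurable_funM; apply/measurable_EFinP.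
  rewrite ge0_integral_fsum//.
  - apply: eq_fsbigr => a; rewrite inE => -[y _ <-].
    rewrite ge0_integralZl_EFin//; last by move=> x _; rewrite mule_ge0// lee_fin.
    rewrite [in RHS]integral_mkcond; congr (_ * _); apply: eq_integral => x _.
    by rewrite epatch_indic.
  - by move=> a; exact: emeasurable_funM.
  - move=> a x _; have [[y _ ya]|nax] := pselect (range h a).
      by rewrite mule_ge0// ?mule_ge0// lee_fin// -ya.
    have : ~ (p @^-1` A a) x by move=> /= pa; apply: nax; exists (p x).
    by move=> npa; rewrite indicE memNset// !mule0.
rewrite E// [RHS](E _ _ la s idfun (@measurable_id _ _ _))//; apply: eq_fsbigr => a _.
by rewrite rs.
Qed.

(** From sets to simple functions, then to their monotone limits. *)
Lemma pushforward_densityP r s :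
  measurable_fun setT r -> (forall x, (0 <= r x)%R) ->
  measurable_fun setT s -> (forall y, (0 <= s y)%R) ->
  (forall A, measurable A ->
    \int[mu]_(x in phi @^-1` A) (r x)%:E = \int[la]_(y in A) (s y)%:E) ->
  pushforward_density r s.
Proof.
move=> mr r0 ms s0 rs; split=> // g mg g0.
pose h := nnsfun_approx measurableT mg.
have E dd (T : measurableType dd) (m : {measure set T -> \bar R}) (q : T -> R)
    (p : T -> Y) : measurable_fun setT p -> measurable_fun setT q ->
    (forall x, (0 <= q x)%R) ->
    \int[m]_x ((q x)%:E * g (p x)) =
    limn (fun n => \int[m]_x ((q x)%:E * (h n (p x))%:E)).
  move=> mp mq q0; rewrite -monotone_convergence//.
  - apply: eq_integral => x _; apply/esym/cvg_lim => //.
    apply: cvgeZl => //.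
    exact: (@cvg_nnsfun_approx _ _ _ _ measurableT _ mg (fun y _ => g0 y)).
  - move=> n; apply: emeasurable_funM; apply/measurable_EFinP => //.
    exact: measurableT_comp.
  - by move=> n x _; rewrite mule_ge0// lee_fin.
  - move=> x _ i j ij; rewrite lee_wpmul2l// ?lee_fin//.
    exact/lefP/nd_nnsfun_approx.
rewrite E// [RHS](E _ _ la s idfun (@measurable_id _ _ _))//; congr (limn _); apply/funext => n.
exact: pushforward_density_nnsfun.
Qed.
End pushforward_density.

Section radon_nikodym.
Local Open Scope ereal_scope.
Context {d d'} {X : measurableType d} {Y : measurableType d'} {R : realType}.
Variables (mu : {measure set X -> \bar R}).
Variables (la : {sigma_finite_measure set Y -> \bar R}) (phi : X -> Y).
Hypothesis mphi : measurable_fun setT phi.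
Hypothesis ac : forall A, measurable A -> la A = 0 -> mu (phi @^-1` A) = 0.

(** The image of r mu can have infinite total mass, but it is finite on each
B n. Its restrictions to the disjoint pieces of the cover are finite measures,
whose Radon-Nikodym derivatives add up to a density. This sum is integrable
over each B n, hence almost everywhere finite, which gives a real-valued
version. *)
Lemma ex_pushforward_density (B : (set Y)^nat) (r : X -> R) :
  (forall n, measurable (B n)) -> \bigcup_n B n = setT ->
  measurable_fun setT r -> (forall x, (0 <= r x)%R) ->
  (forall n, \int[mu]_(x in phi @^-1` B n) (r x)%:E < +oo) ->
  exists s, pushforward_density mu la phi r s.
Proof.
move=> mB BT mr r0 Boo.
have mph A := @measurable_preimage _ _ _ _ phi A mphi.
have mrE A : measurable_fun A (EFin \o r).
  by apply: measurable_funTS; exact/measurable_EFinP.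
pose nu0 A := \int[mu]_(x in phi @^-1` A) (r x)%:E.
have nu00 : nu0 set0 = 0 by rewrite /nu0 preimage_set0 integral_set0.
have nu0_ge0 A : 0 <= nu0 A by apply: integral_ge0 => x _; rewrite lee_fin.
have nu0_sadd : semi_sigma_additive nu0.
  move=> F mF tF mUF; rewrite /nu0 preimage_bigcup ge0_integral_bigcup//.
  - by apply: is_cvg_ereal_nneg_natsum_cond => n _ _; exact: nu0_ge0.
  - by move=> k; exact: mph.
  - by move=> x _; rewrite lee_fin.
  - by move=> i j _ _ [x [Fi Fj]]; apply: tF => //; exists (phi x).
pose nu : {measure set Y -> \bar R} :=
  HB.pack nu0 (isMeasure.Build _ _ _ nu0 nu00 nu0_ge0 nu0_sadd).
have mD n : measurable (seqDU B n).
  by apply: measurableD => //; exact: bigsetU_measurable.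
have nuD n : nu (seqDU B n) < +oo.
  by rewrite (le_lt_trans _ (Boo n))// le_measure ?inE//; exact: subDsetl.
pose nu_ n : {finite_measure set Y -> \bar R} := mfrestr (mD n) (nuD n).
have nu_la n : nu_ n `<< la.
  apply/null_content_dominatesP => A mA laA0.
  change (nu0 (A `&` seqDU B n) = 0); rewrite /nu0.
  apply: null_set_integral => //.
  - by apply: mph; exact: measurableI.
  - apply: subset_measure0 (ac mA laA0) => //; [|exact: mph|by move=> x []].
    by apply: mph; exact: measurableI.
have /choice[h hP] := fun n => radon_nikodym_sigma_finite (nu_la n).
have h0 n y : 0 <= h n y by case: (hP n).
have mh n : measurable_fun setT (h n).
  by case: (hP n) => _ _ /integrableP[].
pose s0 y := \sum_(n <oo) h n y.
have ms0 : measurable_fun setT s0 by exact: ge0_emeasurable_sum.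
have s00 y : 0 <= s0 y by exact: nneseries_ge0.
have s0E A : measurable A -> \int[la]_(y in A) s0 y = nu A.
  move=> mA; rewrite integral_nneseries//; last first.
    by move=> n; exact: measurable_funTS.
  transitivity (\sum_(n <oo) nu (A `&` seqDU B n)).
    by apply: eq_eseriesr => n _; case: (hP n) => _ _ _ <-.
  rewrite -measure_semi_bigcup//.
  - by rewrite -setI_bigcupr -seqDU_bigcup_eq BT setIT.
  - by move=> n; exact: measurableI.
  - exact/trivIset_setIl/trivIset_seqDU.
  - by apply: bigcup_measurable => n _; exact: measurableI.
have s0fin : {ae la, forall y, s0 y \is a fin_num}.
  have : {ae la, forall y, forall n, B n y -> s0 y \is a fin_num}.
    apply/ae_foralln => n; apply: integrable_ae => //.
    apply/integrableP; split; first exact: measurable_funTS.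
    by under eq_integral do rewrite gee0_abs//; rewrite s0E//; exact: Boo.
  apply: filterS => y fy; have : (\bigcup_n B n) y by rewrite BT.
  by case=> n _; exact: fy.
exists (fine \o s0); apply: pushforward_densityP => //.
- exact: measurableT_comp.
- by move=> y; rewrite fine_ge0.
- move=> A mA; rewrite -[LHS]/(nu A) -s0E//.
  apply: ge0_ae_eq_integral => //.
  + exact: measurable_funTS.
  + by apply/measurable_EFinP/measurable_funTS; exact: measurableT_comp.
  + by move=> y _; rewrite lee_fin fine_ge0.
  + by apply: filterS s0fin => y fy _ /=; rewrite fineK.
Qed.
End radon_nikodym.

(** * Complex-valued densities *)

Section complex_integrals.
Context {d} {X : measurableType d} {R : realType}.
Variable mu : {measure set X -> \bar R}.
Implicit Types f g : X -> R[i].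
Local Notation normc := (@Normc.normc R).

Lemma normc_ge0 (z : R[i]) : 0 <= normc z.
Proof. by case: z => a b; exact: sqrtr_ge0. Qed.

Lemma normcE (z : R[i]) : normc z = Num.sqrt (complex.Re z ^+ 2 + complex.Im z ^+ 2).
Proof. by case: z. Qed.

Lemma le_normc_Re (z : R[i]) : `|complex.Re z| <= normc z.
Proof.
by rewrite normcE -sqrtr_sqr ler_wsqrtr// lerDl sqr_ge0.
Qed.

Lemma le_normc_Im (z : R[i]) : `|complex.Im z| <= normc z.
Proof.
by rewrite normcE -sqrtr_sqr ler_wsqrtr// lerDr sqr_ge0.
Qed.

Lemma normcR (x : R) : normc x%:C%C = `|x|.
Proof. by rewrite normcE /= expr0n/= addr0 sqrtr_sqr. Qed.

Lemma normc_conj (z : R[i]) : normc z^* = normc z.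
Proof. by case: z => a b; rewrite !normcE /= sqrrN. Qed.

Lemma mul_conj (z : R[i]) : z * z^* = (normc z ^+ 2)%:C%C.
Proof.
apply/eqP; rewrite eq_complex sqr_normc; case: z => a b /=.
by apply/andP; split; apply/eqP; ring.
Qed.

Lemma measurable_normc f : cmeasurable f ->
  measurable_fun setT (fun x => normc (f x)).
Proof.
move=> /measurable_sqr_normc mf.
rewrite (_ : (fun x => _) = Num.sqrt \o (fun x => normc (f x) ^+ 2)).
  apply: measurableT_comp => //; apply: continuous_measurable_fun.
  exact: sqrt_continuous.
by apply/funext => x /=; rewrite sqrtr_sqr ger0_norm// normc_ge0.
Qed.

Lemma le_cintegrable f (F : X -> R) : cmeasurable f ->
  mu.-integrable setT (EFin \o F) -> (forall x, normc (f x) <= F x) ->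
  cintegrable mu setT f.
Proof.
move=> [f1 f2] iF fF; split; apply: le_integrable iF => //;
  try exact/measurable_EFinP.
- move=> x _ /=; rewrite lee_fin; apply: le_trans (ler_norm _).
  exact: le_trans (le_normc_Re _) (fF x).
- move=> x _ /=; rewrite lee_fin; apply: le_trans (ler_norm _).
  exact: le_trans (le_normc_Im _) (fF x).
Qed.

Lemma cintegrableD f g : cintegrable mu setT f -> cintegrable mu setT g ->
  cintegrable mu setT (fun x => f x + g x).
Proof.
move=> [f1 f2] [g1 g2]; split.
  have := integrableD measurableT f1 g1.
  by apply: eq_integrable => // x _ /=; rewrite ReD.
have := integrableD measurableT f2 g2.
by apply: eq_integrable => // x _ /=; rewrite ImD.
Qed.

Lemma cmeasurableZ a f : cmeasurable f -> cmeasurable (fun x => a * f x).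
Proof. by apply: (@cmeasurableM _ _ _ (cst a)); exact: cmeasurable_cst. Qed.

Lemma cmeasurableR (p : X -> R) : measurable_fun setT p ->
  cmeasurable (fun x => (p x)%:C%C).
Proof. by move=> mp; split => //; exact: measurable_cst. Qed.

End complex_integrals.

Section complex_density.
Context {d d'} {X : measurableType d} {Y : measurableType d'} {R : realType}.
Variables (mu : {measure set X -> \bar R}) (la : {measure set Y -> \bar R}).
Variable (phi : X -> Y).
Hypothesis mphi : measurable_fun setT phi.
Local Notation normc := (@Normc.normc R).

Lemma cmeasurable_comp (g : Y -> R[i]) : cmeasurable g -> cmeasurable (g \o phi).
Proof.
move=> [g1 g2].
by split; [exact: measurableT_comp g1 _|exact: measurableT_comp g2 _].
Qed.

(** The test functions are those for which r (g o phi) is absolutely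
integrable, so that all the integrals in the definition are meaningful. *)
Definition complex_density (r : X -> R[i]) (s : Y -> R[i]) := cmeasurable s /\
  forall g : Y -> R[i], cmeasurable g ->
  mu.-integrable setT (fun x => (normc (r x) * normc (g (phi x)))%:E) ->
  cintegrable la setT (fun y => s y * g y) /\
  cintegral mu setT (fun x => r x * g (phi x)) =
    cintegral la setT (fun y => s y * g y).

(** As r and s are nonnegative, the positive and negative parts of
r (g o phi) and of s g come from those of g. *)
Lemma pushforward_density_integral (r : X -> R) (s g : Y -> R) :
  pushforward_density mu la phi r s ->
  measurable_fun setT r -> (forall x, 0 <= r x) -> measurable_fun setT g ->
  mu.-integrable setT (fun x => (r x * g (phi x))%:E) ->
  la.-integrable setT (fun y => (s y * g y)%:E) /\
  (\int[mu]_x (r x * g (phi x))%:E = \int[la]_y (s y * g y)%:E)%E.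
Proof.
move=> [ms s0 rs] mr r0 mg /integrableP[_ irg].
have mg' : measurable_fun setT (EFin \o g) by exact/measurable_EFinP.
have max0 (a b : R) : 0 <= a -> (maxe (a * b)%:E 0 = a%:E * maxe b%:E 0)%E.
  by move=> a0; rewrite -!EFin_max -EFinM maxr_pMr// mulr0.
split.
  apply/integrableP; split; first by apply/measurable_EFinP/measurable_funM.
  apply: le_lt_trans irg.
  under eq_integral do rewrite EFinM abseM gee0_abs ?lee_fin//.
  rewrite -(rs (abse \o (EFin \o g))); [|exact: measurableT_comp|by move=> y; exact: abse_ge0].
  by under [leRHS]eq_integral do rewrite EFinM abseM gee0_abs ?lee_fin//.
rewrite [LHS]integralE [RHS]integralE; congr (_ - _)%E.
  transitivity (\int[mu]_x ((r x)%:E * (EFin \o g)^\+%E (phi x)))%E.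
    by apply: eq_integral => x _; rewrite !funeposE/= max0.
  rewrite rs//; last exact: measurable_funepos.
  by apply: eq_integral => x _; rewrite !funeposE/= max0.
transitivity (\int[mu]_x ((r x)%:E * (EFin \o g)^\-%E (phi x)))%E.
  by apply: eq_integral => x _; rewrite !funenegE/= -mulrN max0.
rewrite rs//; last exact: measurable_funeneg.
by apply: eq_integral => x _; rewrite !funenegE/= -mulrN max0.
Qed.

Lemma complex_density_ge0 (r : X -> R) (s : Y -> R) :
  pushforward_density mu la phi r s ->
  measurable_fun setT r -> (forall x, 0 <= r x) ->
  complex_density (fun x => (r x)%:C%C) (fun y => (s y)%:C%C).
Proof.
move=> rs mr r0; have [ms s0 _] := rs; split; first exact: cmeasurableR.
move=> g mg irg; have [g1 g2] := mg.
have [irg1 irg2] : cintegrable mu setT (fun x => (r x)%:C%C * g (phi x)).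
  apply: le_cintegrable irg _; last by move=> x; rewrite Normc.normcM.
  by apply: cmeasurableM; [exact: cmeasurableR|exact: cmeasurable_comp].
have eRe (a : R) z : complex.Re (a%:C%C * z) = a * complex.Re z.
  by rewrite ReM /= mul0r subr0.
have eIm (a : R) z : complex.Im (a%:C%C * z) = a * complex.Im z.
  by rewrite ImM /= mul0r addr0.
have [||i1 e1] := @pushforward_density_integral r s (@complex.Re R \o g) rs mr r0.
- exact: g1.
- by apply: eq_integrable irg1 => // x _ /=; rewrite eRe.
have [||i2 e2] := @pushforward_density_integral r s (@complex.Im R \o g) rs mr r0.
- exact: g2.
- by apply: eq_integrable irg2 => // x _ /=; rewrite eIm.
split; first split.
- by apply: eq_integrable i1 => // x _ /=; rewrite eRe.
- by apply: eq_integrable i2 => // x _ /=; rewrite eIm.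
congr Complex; congr fine.
- under eq_integral do rewrite eRe.
  by rewrite e1; apply: eq_integral => y _; rewrite eRe.
- under eq_integral do rewrite eIm.
  by rewrite e2; apply: eq_integral => y _; rewrite eIm.
Qed.

(** The bounds on r1 and r2 make every test function for r a test function
for both terms. They hold when r is split into its real and imaginary parts, and
when these are split into their positive and negative parts. *)
Lemma complex_densityD (a : R[i]) (r r1 r2 : X -> R[i]) (s1 s2 : Y -> R[i]) :
  cmeasurable r1 -> cmeasurable r2 ->
  complex_density r1 s1 -> complex_density r2 s2 ->
  (forall x, r x = r1 x + a * r2 x) ->
  (forall x, normc (r1 x) <= normc (r x)) ->
  (forall x, normc (r2 x) <= normc (r x)) ->
  complex_density r (fun y => s1 y + a * s2 y).
Proof.
move=> mr1 mr2 [ms1 rs1] [ms2 rs2] rE r1r r2r; split.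
  by apply: cmeasurableD => //; exact: cmeasurableZ.
move=> g mg irg.
have dom r' : cmeasurable r' -> (forall x, normc (r' x) <= normc (r x)) ->
    mu.-integrable setT (fun x => (normc (r' x) * normc (g (phi x)))%:E).
  move=> mr' r'r; apply: le_integrable irg => //.
    apply/measurable_EFinP/measurable_funM; apply: measurable_normc => //.
    exact: cmeasurable_comp.
  move=> x _ /=; rewrite lee_fin !normrM ler_wpM2r//.
  by rewrite !ger0_norm ?normc_ge0.
have cint r' : cmeasurable r' -> (forall x, normc (r' x) <= normc (r x)) ->
    cintegrable mu setT (fun x => r' x * g (phi x)).
  move=> mr' r'r; apply: le_cintegrable (dom _ mr' r'r) _.
    by apply: cmeasurableM => //; exact: cmeasurable_comp.
  by move=> x; rewrite Normc.normcM.
have [i1 e1] := rs1 g mg (dom _ mr1 r1r).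
have [i2 e2] := rs2 g mg (dom _ mr2 r2r).
rewrite (_ : (fun y => (s1 y + a * s2 y) * g y) =
  (fun y => s1 y * g y) \+ (fun y => a * (s2 y * g y))); last first.
  by apply/funext => y /=; rewrite mulrDl mulrA.
split; first by apply: cintegrableD => //; exact: cintegrableZ.
rewrite (_ : (fun x => r x * g (phi x)) =
  (fun x => r1 x * g (phi x)) \+ (fun x => a * (r2 x * g (phi x)))); last first.
  by apply/funext => x /=; rewrite rE mulrDl mulrA.
rewrite cintegralD//; [|exact: cint|by apply: cintegrableZ; exact: cint].
rewrite cintegralZ; last exact: cint.
by rewrite cintegralD//; [rewrite cintegralZ// e1 e2|exact: cintegrableZ].
Qed.
End complex_density.

Section ex_complex_density.
Context {d d'} {X : measurableType d} {Y : measurableType d'} {R : realType}.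
Variables (mu : {measure set X -> \bar R}).
Variables (la : {sigma_finite_measure set Y -> \bar R}) (phi : X -> Y).
Hypothesis mphi : measurable_fun setT phi.
Hypothesis ac : forall A, measurable A -> (la A = 0 -> mu (phi @^-1` A) = 0)%E.
Local Notation normc := (@Normc.normc R).

Lemma ex_complex_density (B : (set Y)^nat) (r : X -> R[i]) :
  (forall n, measurable (B n)) -> \bigcup_n B n = setT -> cmeasurable r ->
  (forall n, \int[mu]_(x in phi @^-1` B n) (normc (r x))%:E < +oo)%E ->
  exists s, complex_density mu la phi r s.
Proof.
move=> mB BT mr Boo; have [mr1 mr2] := mr.
have pos (p : X -> R) : measurable_fun setT p -> (forall x, `|p x| <= normc (r x)) ->
    exists s, complex_density mu la phi (fun x => ((p^\+)%R x)%:C%C) s.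
  move=> mp pr; have p0 x : 0 <= p^\+%R x by exact: funrpos_ge0.
  have mp' : measurable_fun setT (p^\+)%R by exact: measurable_funrpos.
  have [|s ps] := ex_pushforward_density mphi ac mB BT mp' p0.
    move=> n; apply: le_lt_trans (Boo n); apply: ge0_le_integral => //.
    - exact: measurable_preimage.
    - by move=> x _; rewrite lee_fin.
    - by apply/measurable_EFinP; exact: measurable_funTS.
    - by apply/measurable_EFinP; apply: measurable_funTS; exact: measurable_normc.
    - move=> x _; rewrite lee_fin; apply: le_trans (pr x).
      by rewrite /funrpos ge_max ler_norm normr_ge0.
  by exists (fun y => (s y)%:C%C); exact: complex_density_ge0.
have real (p : X -> R) : measurable_fun setT p -> (forall x, `|p x| <= normc (r x)) ->
    exists s, complex_density mu la phi (fun x => (p x)%:C%C) s.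
  move=> mp pr.
  have [s1 ps1] := pos p mp pr.
  have [||s2 ps2] := pos (\- p); first exact: measurableT_comp.
    by move=> x /=; rewrite normrN.
  exists (fun y => s1 y + (-1) * s2 y).
  apply: (complex_densityD mphi _ _ ps1 ps2).
  - by apply: cmeasurableR; exact: measurable_funrpos.
  - by apply: cmeasurableR; apply: measurable_funrpos; exact: measurableT_comp.
  - move=> x; rewrite funrposN mulN1r -rmorphN -rmorphD; congr (_%:C%C).
    by rewrite -[in LHS](funrposBneg p).
  - move=> x; rewrite !normcR ger0_norm ?funrpos_ge0//.
    by rewrite /funrpos ge_max ler_norm normr_ge0.
  - move=> x; rewrite !normcR ger0_norm ?funrpos_ge0//.
    by rewrite /funrpos ge_max -normrN ler_norm normr_ge0.
have [|s1 rs1] := real (@complex.Re R \o r) mr1.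
  by move=> x; exact: le_normc_Re.
have [|s2 rs2] := real (@complex.Im R \o r) mr2.
  by move=> x; exact: le_normc_Im.
exists (fun y => s1 y + 'i%C * s2 y).
apply: (complex_densityD mphi _ _ rs1 rs2).
- exact: cmeasurableR.
- exact: cmeasurableR.
- by move=> x; rewrite [LHS]complexE.
- by move=> x; rewrite normcR; exact: le_normc_Re.
- by move=> x; rewrite normcR; exact: le_normc_Im.
Qed.
End ex_complex_density.

(** * Square integrable functions *)

Section L2_facts.
Context {d} {X : measurableType d} {R : realType}.
Variable mu : {measure set X -> \bar R}.
Local Notation normc := (@Normc.normc R).

Lemma ex_L2 (f : X -> R[i]) : cmeasurable f ->
  (\int[mu]_x (normc (f x) ^+ 2)%:E < +oo)%E ->
  exists u : L2 mu, {ae mu, forall x, u x = f x}.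
Proof.
move=> mf fi; have sf : f \in square_integrable mu by apply/asboolP.
by exists (\pi_(L2 mu)%qT (MkL2fun sf)); exact: L2_piE.
Qed.

Lemma L2_lty (u : L2 mu) : (\int[mu]_x (normc (u x) ^+ 2)%:E < +oo)%E.
Proof. by have /asboolP[] := L2_square_integrable u. Qed.

Lemma L2_integrable (u : L2 mu) :
  mu.-integrable setT (fun x => (normc (u x) ^+ 2)%:E).
Proof. by have /square_integrableP[] := L2_square_integrable u. Qed.

Lemma L2BE (u v : L2 mu) : {ae mu, forall x, (u - v : L2 mu) x = u x - v x}.
Proof.
rewrite -scaleN1r; apply: filterS2 (L2DE u (-1 *: v)) (L2scaleE (-1) v) => x -> e.
by rewrite [L2_fun (_ *: _) x]e mulN1r.
Qed.

Lemma L2PE a (u v : L2 mu) : {ae mu, forall x, (a *: u + v : L2 mu) x = a * u x + v x}.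
Proof.
apply: filterS2 (L2DE (a *: u) v) (L2scaleE a u) => x -> e.
by rewrite [L2_fun (_ *: _) x]e.
Qed.

Lemma L2_0E : {ae mu, forall x, (0 : L2 mu) x = 0}.
Proof.
by have := L2_piE (0 : L2fun mu); rewrite raddf0; apply: filterS => x ->.
Qed.

Lemma L2dotE (u : L2 mu) :
  L2dot mu u u = (\int[mu]_x (normc (u x) ^+ 2))%:C%C.
Proof.
rewrite /L2dot (_ : (fun x => _) = fun x => (normc (u x) ^+ 2)%:C%C).
  by congr Complex; rewrite Rintegral_cst// mul0r.
by apply/funext => x; exact: mul_conj.
Qed.

Lemma L2dot_lt (u : L2 mu) (e : R) :
  (L2dot mu u u < e%:C%C ^+ 2) =
  (\int[mu]_x (normc (u x) ^+ 2)%:E < (e ^+ 2)%:E)%E.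
Proof.
rewrite L2dotE -rmorphXn/= ltcR -lte_fin fineK//.
exact/integrable_fin_num/L2_integrable.
Qed.

Lemma ae_eq_L2_integral (f g : X -> R[i]) : cmeasurable f -> cmeasurable g ->
  {ae mu, forall x, f x = g x} ->
  (\int[mu]_x (normc (f x) ^+ 2)%:E = \int[mu]_x (normc (g x) ^+ 2)%:E)%E.
Proof.
move=> mf mg fg; apply: ge0_ae_eq_integral => //.
- exact/measurable_EFinP/measurable_sqr_normc.
- exact/measurable_EFinP/measurable_sqr_normc.
- by move=> x _; rewrite lee_fin sqr_ge0.
- by move=> x _; rewrite lee_fin sqr_ge0.
- by apply: filterS fg => x -> _.
Qed.

Lemma chebyshev_normc (f : X -> R[i]) (A : set X) (c : R) : cmeasurable f ->
  measurable A -> 0 <= c -> (forall x, A x -> c <= normc (f x)) ->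
  ((c ^+ 2)%:E * mu A <= \int[mu]_x (normc (f x) ^+ 2)%:E)%E.
Proof.
move=> mf mA c0 cf; have mf2 := measurable_sqr_normc mf.
rewrite -integral_cst// (@le_trans _ _ (\int[mu]_(x in A) (normc (f x) ^+ 2)%:E)%E)//.
  apply: ge0_le_integral => //.
  - by move=> x _; rewrite lee_fin sqr_ge0.
  - exact/measurable_EFinP/measurable_funTS.
  - by move=> x Ax; rewrite lee_fin ler_pXn2r// ?nnegrE ?normc_ge0// cf.
apply: ge0_subset_integral => //; first exact/measurable_EFinP.
by move=> x _; rewrite lee_fin sqr_ge0.
Qed.
End L2_facts.

(** * Sigma-finiteness of the image measure *)

Section exhaustion.
Context {d} {X : measurableType d} {R : realType}.
Variable mu : {sigma_finite_measure set X -> \bar R}.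
Variable phi : X -> X.
Hypothesis mphi : measurable_fun setT phi.
Local Notation normc := (@Normc.normc R).

Lemma comp_dominated : comp_densely_defined mu phi ->
  forall A, measurable A -> (mu A = 0 -> mu (phi @^-1` A) = 0)%E.
Proof.
move=> [/null_content_dominatesP dom _] A mA /(dom A mA).
rewrite /pushforward /weighted_measure; under eq_integral do rewrite Normc.normc1 expr1n.
by rewrite integral_cst ?mul1e//; exact: measurable_preimage.
Qed.

Lemma ae_comp (P : X -> Prop) :
  (forall A, measurable A -> (mu A = 0 -> mu (phi @^-1` A) = 0)%E) ->
  {ae mu, forall x, P x} -> {ae mu, forall x, P (phi x)}.
Proof.
move=> ac [N [mN N0 PN]]; exists (phi @^-1` N); split.
- exact: measurable_preimage.
- exact: ac.
- by move=> x /= nP; exact: PN.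
Qed.

(** Approximate the indicator of a set F of finite measure by a function g
in the domain of the composition operator, and let G be the set where
|g| >= 1 / 2. By Chebyshev's inequality G has finite measure because g is
square integrable, and its preimage has finite measure because g o phi is. The
measure of F minus G is small because |1 - g| > 1 / 2 there. What is left by all
these sets G is null, hence so is its preimage; adding it to each of them gives
a cover, whose finite unions increase. *)
Lemma comp_exhaustion : comp_densely_defined mu phi ->
  exists B : (set X)^nat, [/\ forall n, measurable (B n), nondecreasing_seq B,
    \bigcup_n B n = setT, forall n, (mu (B n) < +oo)%E &
    forall n, (mu (phi @^-1` B n) < +oo)%E].
Proof.
move=> cd; have ac := comp_dominated cd; have [_ dense] := cd.
have mph A := @measurable_preimage _ _ _ _ phi A mphi.
have [F TF /all_and2[mF Foo]] := sigma_finiteT mu.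
pose h : R := 2^-1; have h0 : 0 < h by rewrite invr_gt0.
have approx (nm : nat * nat) : exists G, [/\ measurable G, (mu G < +oo)%E,
    (mu (phi @^-1` G) < +oo)%E &
    ((h ^+ 2)%:E * mu (F nm.1 `\` G) < (nm.2.+1%:R^-1 ^+ 2)%:E)%E].
  have mi : cmeasurable (fun x => (\1_(F nm.1) x)%:C%C : R[i]) by exact: cmeasurableR.
  have [|f fE] := @ex_L2 _ _ _ mu _ mi.
    rewrite (_ : (fun x => _) = (fun x => (\1_(F nm.1) x)%:E)).
      by rewrite integral_indic// setIT; exact: Foo.
    apply/funext => x; rewrite normcR indicE; case: (_ \in _);
      by rewrite /= ?normr1 ?normr0 ?expr1n ?expr0n.
  have : norm_closure (L2dot mu) (op_dom (wcomp mu phi (cst 1))) f by rewrite dense.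
  case/(_ (nm.2.+1%:R^-1)%:C%C); first by rewrite ltcR invr_gt0 ltr0Sn.
  move=> g0 [p0 /= gp]; rewrite L2dot_lt => fg.
  pose g : X -> R[i] := L2_fun g0; pose p : X -> R[i] := L2_fun p0.
  have mg : cmeasurable g := cmeasurable_L2 g0; have mp : cmeasurable p := cmeasurable_L2 p0.
  have mG : measurable [set x | h <= normc (g x)].
    by apply: measurable_ler_set => //; exact: measurable_normc.
  have fin (A : set X) (q : X -> R[i]) : measurable A -> cmeasurable q ->
      (forall x, A x -> h <= normc (q x)) ->
      (\int[mu]_x (normc (q x) ^+ 2)%:E < +oo)%E -> (mu A < +oo)%E.
    move=> mA mq hq qoo.
    have : ((h ^+ 2)%:E * mu A < +oo)%E.
      exact: le_lt_trans (chebyshev_normc mu mq mA (ltW h0) hq) qoo.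
    rewrite !ltey; apply: contra => /eqP ->.
    by rewrite gt0_muley// lte_fin exprn_gt0.
  exists [set x | h <= normc (g x)]; split => //.
  - by apply: (fin _ g) => //; exact: L2_lty.
  - apply: (fin _ (g \o phi)) => //; [exact: mph|exact: cmeasurable_comp|].
    rewrite (ae_eq_L2_integral _ mp); first exact: L2_lty.
      exact: cmeasurable_comp.
    by apply: filterS gp => x; rewrite /= mul1r => px; exact: esym.
  - apply: le_lt_trans fg; have mfg := cmeasurable_L2 (f - g0).
    have mq : cmeasurable (fun x => (\1_(F nm.1) x)%:C%C - g x).
      rewrite (_ : (fun x => _) = (fun x => (\1_(F nm.1) x)%:C%C) \+ (fun x => -1 * g x)).
        by apply: cmeasurableD => //; exact: cmeasurableZ.
      by apply/funext => x /=; rewrite mulN1r.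
    rewrite (ae_eq_L2_integral mfg mq); last first.
      by apply: filterS2 (L2BE f g0) fE => x -> ->.
    apply: chebyshev_normc => //; [exact: measurableD|exact: ltW|].
    move=> x [Fx /negP]; rewrite -ltNge => gx.
    rewrite indicE mem_set//=.
    have := le_normcD (1 - g x) (g x); rewrite subrK Normc.normc1 => le1.
    by rewrite -(@lerD2r _ (normc (g x))) (le_trans _ le1)//; move: gx; rewrite /h; lra.
have [G GP] := choice approx.
pose N := ~` \bigcup_nm G nm.
have mU : measurable (\bigcup_nm G nm).
  apply: countable_bigcupT_measurable => // nm; by case: (GP nm).
have mN : measurable N by exact: measurableC.
have N0 : mu N = 0%E.
  have N_n n : mu (F n `&` N) = 0%E.
    apply/eqP; rewrite eq_le measure_ge0 andbT; apply/lee_addgt0Pr => e e0; rewrite add0e.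
    have [m] := @ltr_add_invr R 0 (h ^+ 2 * e) (mulr_gt0 (exprn_gt0 2 h0) e0).
    rewrite add0r => me; case: (GP (n, m)) => /= mG _ _ Gm.
    have : (mu (F n `\` G (n, m)) <= e%:E)%E.
      rewrite -(@lee_pmul2l _ (h ^+ 2)%:E)//; last by rewrite lte_fin exprn_gt0.
      apply: (le_trans (ltW Gm)); rewrite -EFinM lee_fin (le_trans _ (ltW me))//.
      by rewrite expr2 ger_pMl ?invr_gt0// invf_le1// ler1n.
    apply: le_trans; apply: le_measure; rewrite ?inE.
    - exact: measurableI.
    - exact: measurableD.
    - by move=> x [Fx Nx]; split=> // Gx; apply: Nx; exists (n, m).
  have -> : N = \bigcup_n (F n `&` N) by rewrite -setI_bigcupl -TF setTI.
  have mFN n : measurable (F n `&` N) by exact: measurableI.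
  apply/negligibleP; first exact: bigcupT_measurable.
  apply: negligible_bigcup => n; apply/negligibleP; [exact: mFN|exact: N_n].
pose P A := [/\ measurable A, (mu A < +oo)%E & (mu (phi @^-1` A) < +oo)%E].
have PU A B : P A -> P B -> P (A `|` B).
  move=> [mA A1 A2] [mB B1 B2]; split; first exact: measurableU.
    by apply: le_lt_trans (measureU2 _ _ _) _ => //; rewrite lte_add_pinfty.
  rewrite preimage_setU; apply: le_lt_trans (measureU2 _ _ _) _; try exact: mph.
  by rewrite lte_add_pinfty.
have PN : P N by split=> //; rewrite ?N0 ?ac.
pose B0 i := if unpickle i is Some nm then G nm `|` N else N.
have PB0 i : P (B0 i).
  rewrite /B0; case: unpickle => [nm|//]; apply: PU => //.
  by case: (GP nm) => *; split.
exists (fun n => \big[setU/set0]_(i < n.+1) B0 i).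
have PB n : P (\big[setU/set0]_(i < n.+1) B0 i).
  elim/big_ind : _ => [|//|i _]; last exact: PB0.
  by split => //; rewrite ?preimage_set0 measure0.
split; try by move=> n; case: (PB n).
- by move=> i j ij; exact/subsetPset/subset_bigsetU.
- rewrite bigcup_bigsetU_bigcup; apply/seteqP; split => // x _.
  have [[nm _ Gx]|Nx] := pselect ((\bigcup_nm G nm) x).
    by exists (pickle nm) => //; rewrite /B0 pickleK; left.
  exists 0%N => //; rewrite /B0; case: unpickle => [nm|//]; by right.
Qed.
End exhaustion.

(** * Integrals of products and vanishing integrals *)

Section integral_facts.
Context {d} {X : measurableType d} {R : realType}.
Variable mu : {measure set X -> \bar R}.
Local Notation normc := (@Normc.normc R).

Lemma integral0_ae0 (F : X -> R) : measurable_fun setT F ->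
  (forall x, 0 <= F x) -> (\int[mu]_x (F x)%:E = 0)%E ->
  {ae mu, forall x, F x = 0}.
Proof.
move=> mF F0 iF; have mF' : measurable_fun setT (EFin \o F) by exact/measurable_EFinP.
have : (\int[mu]_x `|(EFin \o F) x| = 0)%E.
  by under eq_integral do rewrite gee0_abs ?lee_fin//.
move=> /(ae_eq_integral_abs mu measurableT mF'); apply: filterS => x /(_ I) [].
by [].
Qed.

Lemma cintegral0_ae0 (F : X -> R) : (forall x, 0 <= F x) ->
  cintegrable mu setT (fun x => (F x)%:C%C) ->
  cintegral mu setT (fun x => (F x)%:C%C) = 0 ->
  {ae mu, forall x, F x = 0}.
Proof.
move=> F0 [iF _] [cF _]; apply: integral0_ae0 => //.
  by apply/measurable_EFinP; exact: measurable_int iF.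
by rewrite -[LHS]fineK ?[X in X%:E = _]cF//; exact: integrable_fin_num.
Qed.

Lemma integrable_normM (f g : X -> R[i]) : cmeasurable f -> cmeasurable g ->
  (\int[mu]_x (normc (f x) ^+ 2)%:E < +oo)%E ->
  (\int[mu]_x (normc (g x) ^+ 2)%:E < +oo)%E ->
  mu.-integrable setT (fun x => (normc (f x) * normc (g x))%:E).
Proof.
move=> mf mg fi gi.
have sq (h : X -> R[i]) : cmeasurable h -> (\int[mu]_x (normc (h x) ^+ 2)%:E < +oo)%E ->
    mu.-integrable setT (fun x => (normc (h x) ^+ 2)%:E).
  move=> mh hi; apply/integrableP; split; first exact/measurable_EFinP/measurable_sqr_normc.
  by under eq_integral do rewrite gee0_abs ?lee_fin ?sqr_ge0//.
apply: le_integrable (integrableD measurableT (sq f mf fi) (sq g mg gi)) => //.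
  by apply/measurable_EFinP/measurable_funM; exact: measurable_normc.
move=> x _ /=; rewrite lee_fin ger0_norm ?mulr_ge0 ?normc_ge0//.
rewrite ger0_norm ?addr_ge0 ?sqr_ge0//.
have := sqr_ge0 (normc (f x) - normc (g x)).
by have := sqr_ge0 (normc (f x) + normc (g x)); nra.
Qed.

Lemma L2_ae_lty (u : L2 mu) (f : X -> R[i]) : cmeasurable f ->
  {ae mu, forall x, u x = f x} -> (\int[mu]_x (normc (f x) ^+ 2)%:E < +oo)%E.
Proof.
by move=> mf uf; rewrite -(ae_eq_L2_integral (cmeasurable_L2 u) mf uf) L2_lty.
Qed.

Lemma truncated_lty (f : X -> R[i]) (p : X -> R) (A : set X) (c : R) :
  measurable A -> cmeasurable f -> measurable_fun setT p -> (forall x, 0 <= p x) ->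
  0 <= c -> (forall x, normc (f x) ^+ 2 <= c * (p x * \1_A x)) ->
  (\int[mu]_(x in A) (p x)%:E < +oo)%E ->
  (\int[mu]_x (normc (f x) ^+ 2)%:E < +oo)%E.
Proof.
move=> mA mf mp p0 c0 fp pA.
have mpA : measurable_fun setT (fun x => p x * \1_A x) by exact: measurable_funM.
have pA0 x : 0 <= p x * \1_A x by rewrite mulr_ge0// indicE; case: (_ \in _).
apply: (@le_lt_trans _ _ (\int[mu]_x (c%:E * (p x * \1_A x)%:E))%E).
  apply: ge0_le_integral => //.
  - by move=> x _; rewrite lee_fin sqr_ge0.
  - exact/measurable_EFinP/measurable_sqr_normc.
  - by apply/measurable_EFinP; exact: measurable_funM.
  - by move=> x _; rewrite -EFinM lee_fin fp.
rewrite ge0_integralZl_EFin//; [|by move=> x _; rewrite lee_fin|exact/measurable_EFinP].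
rewrite lte_mul_pinfty// ?lee_fin//.
by move: pA; rewrite integral_mkcond epatch_indic.
Qed.

Lemma integrable_conj_on (f : L2 mu) (w : X -> R[i]) (D : set X) :
  measurable D -> cmeasurable w ->
  (\int[mu]_(x in D) (normc (w x) ^+ 2)%:E < +oo)%E ->
  mu.-integrable setT (fun x => (normc (f x * (w x)^*) * \1_D x)%:E).
Proof.
move=> mD mw wD; pose v x := w x * (\1_D x)%:C%C.
have mv : cmeasurable v by apply: cmeasurableM => //; exact: cmeasurableR.
have vE x : normc (v x) = normc (w x) * \1_D x.
  by rewrite Normc.normcM normcR ger0_norm// indicE; case: (_ \in _).
have v2 : (\int[mu]_x (normc (v x) ^+ 2)%:E < +oo)%E.
  apply: (@truncated_lty v (fun x => normc (w x) ^+ 2) D 1) => //.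
  - exact: measurable_sqr_normc.
  - by move=> x; exact: sqr_ge0.
  - move=> x; rewrite vE mul1r exprMn indicE.
    by case: (_ \in _); rewrite ?expr1n ?expr0n.
have := integrable_normM (cmeasurable_L2 f) mv (L2_lty f) v2.
apply: eq_integrable => // x _.
by rewrite vE Normc.normcM normc_conj mulrA.
Qed.
End integral_facts.

(** * The reciprocal of a weighted composition operator *)

Section wcomp_theory.
Context {d} {X : measurableType d} {R : realType}.
Variable mu : {sigma_finite_measure set X -> \bar R}.
Variables (phi : X -> X) (w : X -> R[i]).
Hypothesis mphi : measurable_fun setT phi.
Hypothesis mw : cmeasurable w.
Hypothesis ac : forall A, measurable A -> (mu A = 0 -> mu (phi @^-1` A) = 0)%E.
Local Notation normc := (@Normc.normc R).
Local Notation T := (wcomp mu phi w).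
Local Notation perp := (orthogonal_complement (L2dot mu)).

Lemma wcomp_linear : linear_operator T.
Proof.
split; [split|].
- apply: filterS2 (L2_0E mu) (ae_comp mphi ac (L2_0E mu)) => x.
  by rewrite /= => e1 e2; rewrite [LHS]e1 [X in _ * X]e2 mulr0.
- move=> a [f p] [g q] /= Tfp Tgq.
  apply: filterS2 (filterI Tfp Tgq)
    (filterI (L2PE a p q) (ae_comp mphi ac (L2PE a f g))) => x [/= e1 e2] [/= e3 e4].
  rewrite [LHS]e3 [X in _ = _ * X]e4 e1 e2; ring.
- move=> f g g' /= Tg Tg'; apply/L2P.
  by apply: filterS2 Tg Tg' => x /= -> ->.
Qed.

Variable sw : X -> R.
Hypothesis swP : pushforward_density mu mu phi (fun x => normc (w x) ^+ 2) sw.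
Local Notation sw_ge0 := (let: And3 _ h _ := swP in h).
Local Notation m_sw := (let: And3 h _ _ := swP in h).

Let mwc (g : X -> R[i]) : cmeasurable g -> cmeasurable (fun x => w x * g (phi x)).
Proof. by move=> mg; apply: cmeasurableM => //; exact: cmeasurable_comp. Qed.

(** The operator T is isometric for the norm of L^2(sw mu) on its domain. *)
Lemma wcomp_norm (g : X -> R[i]) : cmeasurable g ->
  (\int[mu]_x (normc (w x * g (phi x)) ^+ 2)%:E =
   \int[mu]_y (sw y * normc (g y) ^+ 2)%:E)%E.
Proof.
move=> mg; have [_ _ swE] := swP.
have := swE (fun y => (normc (g y) ^+ 2)%:E).
rewrite (_ : (fun x => _ * _)%E = fun x => (normc (w x * g (phi x)) ^+ 2)%:E); last first.
  by apply/funext => x; rewrite Normc.normcM exprMn EFinM.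
apply; first exact/measurable_EFinP/measurable_sqr_normc.
by move=> y; rewrite lee_fin sqr_ge0.
Qed.

Lemma wcomp_eq0 (g : X -> R[i]) : cmeasurable g ->
  {ae mu, forall x, w x * g (phi x) = 0} <-> {ae mu, forall y, sw y != 0 -> g y = 0}.
Proof.
move=> mg; split => [wg0|g0].
  have : (\int[mu]_y (sw y * normc (g y) ^+ 2)%:E = 0)%E.
    rewrite -wcomp_norm// -[RHS](integral0 mu setT).
    rewrite (ae_eq_L2_integral (mwc mg) (cmeasurable_cst 0) wg0).
    by apply: eq_integral => x _; rewrite Normc.normc0 expr0n.
  move=> /integral0_ae0 h; have {h} := h (measurable_funM m_sw (measurable_sqr_normc mg))
    (fun y => mulr_ge0 (sw_ge0 y) (sqr_ge0 _)).
  apply: filterS => y /eqP; rewrite mulf_eq0 sqrf_eq0 => /orP[->//|].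
  by move=> /eqP/Normc.eq0_normc.
have : (\int[mu]_x (normc (w x * g (phi x)) ^+ 2)%:E = 0)%E.
  rewrite wcomp_norm// -[RHS](integral0 mu setT); apply: ge0_ae_eq_integral => //.
  - by apply/measurable_EFinP/measurable_funM; [exact: m_sw|exact: measurable_sqr_normc].
  - by move=> y _; rewrite lee_fin mulr_ge0 ?sw_ge0 ?sqr_ge0.
  - apply: filterS g0 => y g0 _; have [->|/g0 ->] := eqVneq (sw y) 0.
      by rewrite mul0r.
    by rewrite Normc.normc0 expr0n mulr0.
move=> /integral0_ae0 h; have {h} := h (measurable_sqr_normc (mwc mg)) (fun=> sqr_ge0 _).
by apply: filterS => x /eqP; rewrite sqrf_eq0 => /eqP/Normc.eq0_normc.
Qed.

Lemma wcomp_kerP (f : L2 mu) :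
  op_ker T f <-> {ae mu, forall y, sw y != 0 -> f y = 0}.
Proof.
rewrite -(wcomp_eq0 (cmeasurable_L2 f)); split => h.
  by apply: filterS2 h (L2_0E mu) => x /= <-.
by apply: filterS2 h (L2_0E mu) => x -> /=.
Qed.

(** Restriction to the set where sw = 0, the orthogonal projection onto the
kernel of T. *)
Definition null_part (f : X -> R[i]) (y : X) : R[i] :=
  f y * (\1_[set y | sw y = 0] y)%:C%C.

Lemma null_partE f y : null_part f y = if sw y == 0 then f y else 0.
Proof.
rewrite /null_part indicE; case: eqVneq => [h|/eqP h].
  by rewrite mem_set// mulr1.
by rewrite memNset// mulr0.
Qed.

Lemma cmeasurable_null_part f : cmeasurable f -> cmeasurable (null_part f).
Proof.
move=> mf; apply: cmeasurableM => //; apply: cmeasurableR.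
apply: measurable_indic; apply: measurable_eqr_set => //; exact: m_sw.
Qed.

Lemma ex_null_part (f : L2 mu) :
  exists2 k : L2 mu, {ae mu, forall y, k y = null_part f y} & op_ker T k.
Proof.
have mf := cmeasurable_L2 f; have mk := cmeasurable_null_part mf.
have [|k kE] := @ex_L2 _ _ _ mu _ mk.
  apply: le_lt_trans (L2_lty f); apply: ge0_le_integral => //.
  - by move=> y _; rewrite lee_fin sqr_ge0.
  - exact/measurable_EFinP/measurable_sqr_normc.
  - exact/measurable_EFinP/measurable_sqr_normc.
  - move=> y _; rewrite lee_fin null_partE; case: ifP => // _.
    by rewrite Normc.normc0 expr0n sqr_ge0.
exists k => //; apply/wcomp_kerP; apply: filterS kE => y ->.
by rewrite null_partE => /negbTE ->.
Qed.

Lemma wcomp_perp_kerP (f : L2 mu) :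
  perp (op_ker T) f <-> {ae mu, forall y, sw y = 0 -> f y = 0}.
Proof.
have mf := cmeasurable_L2 f; split => [pf|f0 k /wcomp_kerP k0].
  have [k kE kT] := ex_null_part f; have := pf k kT.
  rewrite /L2dot => I0.
  have : {ae mu, forall y, normc (null_part f y) ^+ 2 = 0}.
    have e : {ae mu, forall y, f y * (k y)^* = (normc (null_part f y) ^+ 2)%:C%C}.
      apply: filterS kE => y ->; rewrite null_partE; case: ifP => _.
        by rewrite mul_conj.
      by rewrite Normc.normc0 expr0n rmorph0 mulr0.
    have mn : cmeasurable (fun y => (normc (null_part f y) ^+ 2)%:C%C : R[i]).
      by apply: cmeasurableR; apply: measurable_sqr_normc; exact: cmeasurable_null_part.
    have mfk := cmeasurableM mf (cmeasurable_conj (cmeasurable_L2 k)).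
    apply: cintegral0_ae0.
    - by move=> y; exact: sqr_ge0.
    - apply: le_cintegrable (L2_integrable f) _ => // y.
      rewrite normcR ger0_norm ?sqr_ge0// null_partE; case: ifP => // _.
      by rewrite Normc.normc0 expr0n sqr_ge0.
    - by rewrite -(cintegral_ae_eq mfk mn e).
  apply: filterS => y /eqP; rewrite sqrf_eq0 => /eqP/Normc.eq0_normc.
  by rewrite null_partE => h sw0; move: h; rewrite sw0 eqxx.
have mfk := cmeasurableM mf (cmeasurable_conj (cmeasurable_L2 k)).
transitivity (cintegral mu setT (cst 0)).
  apply: cintegral_ae_eq => //; first exact: cmeasurable_cst.
  apply: filterS2 f0 k0 => y f0 k0; have [/f0 ->|/k0 ->] := eqVneq (sw y) 0.
    by rewrite mul0r.
  by rewrite rmorph0 mulr0.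
by rewrite /cintegral !Rintegral_cst// !mul0r.
Qed.

Lemma wcomp_kernel_decomposition : has_kernel_decomposition (L2dot mu) T.
Proof.
have [[T0 lT] fT] := wcomp_linear.
apply/seteqP; split => [f [p Tfp]|_ [k Tk [h [[q Thq] _] <-]]]; last first.
  exists (0 + q); have := lT 1 _ _ Tk Thq.
  by congr T; congr pair => /=; rewrite scale1r.
have [k kE kT] := ex_null_part f.
exists k => //; exists (f - k); last by rewrite addrC subrK.
split.
  exists p; have := lT (-1) _ _ kT Tfp.
  congr T; congr pair => /=; last by rewrite scaler0 add0r.
  by rewrite scaleN1r addrC.
apply/wcomp_perp_kerP; apply: filterS2 kE (L2BE f k) => y ky -> sw0.
by rewrite ky null_partE sw0 eqxx subrr.
Qed.

Hypothesis w_neq0 : {ae mu, forall x, w x != 0}.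
Variable B : (set X)^nat.
Hypothesis mB : forall n, measurable (B n).
Hypothesis ndB : nondecreasing_seq B.
Hypothesis BT : \bigcup_n B n = setT.
Hypothesis muB : forall n, (mu (B n) < +oo)%E.
Hypothesis wB : forall n, (\int[mu]_(x in phi @^-1` B n) (normc (w x) ^+ 2)%:E < +oo)%E.

Let mph A : measurable A -> measurable (phi @^-1` A).
Proof. exact: measurable_preimage. Qed.

(** A function truncated to this set is bounded and vanishes off B n; so it
is in L^2 and in the domain of T, whatever the function. *)
Definition trunc_set (u : X -> R[i]) n := [set y | normc (u y) <= n%:R] `&` B n.

Definition trunc (u : X -> R[i]) n y : R[i] := u y * (\1_(trunc_set u n) y)%:C%C.

Lemma measurable_trunc_set u n : cmeasurable u -> measurable (trunc_set u n).
Proof.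
move=> mu_; apply: measurableI => //.
by apply: measurable_ler_set => //; exact: measurable_normc.
Qed.

Lemma cmeasurable_trunc u n : cmeasurable u -> cmeasurable (trunc u n).
Proof.
move=> mu_; apply: cmeasurableM => //; apply: cmeasurableR.
by apply: measurable_indic; exact: measurable_trunc_set.
Qed.

Lemma trunc_in u n y : trunc_set u n y -> trunc u n y = u y.
Proof. by move=> uy; rewrite /trunc indicE mem_set// mulr1. Qed.

Lemma trunc_notin u n y : ~ trunc_set u n y -> trunc u n y = 0.
Proof. by move=> uy; rewrite /trunc indicE memNset// mulr0. Qed.

Lemma trunc_set_nd u n m : (n <= m)%N -> trunc_set u n `<=` trunc_set u m.
Proof.
move=> nm y [/= un Bn]; split => /=; first by rewrite (le_trans un)// ler_nat.
by have /subsetPset := ndB nm; exact.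
Qed.

Lemma trunc_set_cover u y : \forall n \near \oo, trunc_set u n y.
Proof.
have : (\bigcup_n B n) y by rewrite BT.
move=> [m _ Bm]; near=> n.
have [N [uN mN]] : exists N, trunc_set u N y /\ (N <= n)%N; last first.
  exact: trunc_set_nd uN.
exists (maxn m (Num.bound (normc (u y)))); split.
  split => /=.
    apply: ltW; apply: lt_le_trans (archi_boundP (normc_ge0 _)) _.
    by rewrite ler_nat leq_maxr.
  by have /subsetPset := ndB (leq_maxl m (Num.bound (normc (u y)))); exact.
near: n; exact: nbhs_infty_ge.
Unshelve. all: by end_near.
Qed.

Lemma normc_trunc_le u n y : normc (trunc u n y) ^+ 2 <= n%:R ^+ 2 * \1_(B n) y.
Proof.
have [[/= un Bn]|h] := pselect (trunc_set u n y).
  by rewrite trunc_in// indicE mem_set// mulr1 ler_pXn2r// ?nnegrE ?normc_ge0.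
rewrite trunc_notin// Normc.normc0 expr0n mulr_ge0// ?sqr_ge0.
Qed.

Lemma ex_trunc u n : cmeasurable u -> exists un qn : L2 mu,
  {ae mu, forall y, un y = trunc u n y} /\
  {ae mu, forall x, qn x = w x * trunc u n (phi x)}.
Proof.
move=> m_u; have mt := cmeasurable_trunc n m_u.
have [|un unE] := @ex_L2 _ _ _ mu _ mt.
  apply: (@truncated_lty _ _ _ mu _ (cst 1) (B n) (n%:R ^+ 2)) => //.
  - by move=> y; rewrite mul1r; exact: normc_trunc_le.
  - by rewrite -[X in (X < _)%E]/(\int[mu]_(x in B n) cst 1%E x)%E integral_cst// mul1e; exact: muB.
have [|qn qnE] := @ex_L2 _ _ _ mu _ (mwc mt); last by exists un, qn.
apply: (@truncated_lty _ _ _ mu _ (fun x => normc (w x) ^+ 2) (phi @^-1` B n) (n%:R ^+ 2)) => //.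
- exact: mph.
- exact: mwc.
- exact: measurable_sqr_normc.
- by move=> x; exact: sqr_ge0.
- move=> x; rewrite Normc.normcM exprMn [leRHS]mulrCA ler_wpM2l ?sqr_ge0//.
  exact: normc_trunc_le.
Qed.

Let swC : complex_density mu mu phi (fun x => (normc (w x) ^+ 2)%:C%C) (fun y => (sw y)%:C%C).
Proof.
apply: complex_density_ge0 => //; first exact: measurable_sqr_normc.
by move=> x; exact: sqr_ge0.
Qed.

(** Polarised form of [wcomp_norm]. Only the images of u and g have to be
square integrable, not u and g themselves. *)
Lemma wcomp_dot (u g : X -> R[i]) (q p : L2 mu) : cmeasurable u -> cmeasurable g ->
  {ae mu, forall x, q x = w x * u (phi x)} ->
  {ae mu, forall x, p x = w x * g (phi x)} ->
  cintegrable mu setT (fun y => (sw y)%:C%C * (u y * (g y)^*)) /\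
  L2dot mu q p = cintegral mu setT (fun y => (sw y)%:C%C * (u y * (g y)^*)).
Proof.
move=> m_u mg qE pE; have [_ h] := swC.
have mug : cmeasurable (fun y => u y * (g y)^*).
  by apply: cmeasurableM => //; exact: cmeasurable_conj.
have [|i e] := h _ mug.
  apply: eq_integrable (integrable_normM (mwc m_u) (mwc mg)
    (L2_ae_lty (mwc m_u) qE) (L2_ae_lty (mwc mg) pE)) => //.
  move=> x _; rewrite !Normc.normcM normcR normc_conj ger0_norm ?sqr_ge0//; congr EFin; ring.
split => //; rewrite -e; apply: cintegral_ae_eq.
- exact: cmeasurableM (cmeasurable_L2 q) (cmeasurable_conj (cmeasurable_L2 p)).
- apply: cmeasurableM; first by apply: cmeasurableR; exact: measurable_sqr_normc.
  exact: cmeasurable_comp mug.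
- apply: filterS2 qE pE => x -> ->; rewrite -mul_conj rmorphM /=; ring.
Qed.

Section reciprocal_value.
Variables (f : L2 mu) (s : X -> R[i]).
Hypothesis sP : complex_density mu mu phi (fun x => f x * (w x)^*) s.

(** The quotient of s / h by sw / h, where h is the density of the image of
mu. It is 0 where sw = 0. *)
Definition dagger_value (y : X) : R[i] := s y * ((sw y)^-1)%:C%C.
Local Notation u := dagger_value.

Lemma cmeasurable_dagger_value : cmeasurable u.
Proof.
apply: cmeasurableM; first exact: sP.1.
apply: cmeasurableR; apply: measurable_inv_ge0; [exact: m_sw|exact: sw_ge0].
Qed.

(** The integral of |w|^2 over the preimage of the set where sw = 0 is the
integral of sw over this set. *)
Lemma phi_notin_null : {ae mu, forall x, sw (phi x) != 0}.
Proof.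
have mZ : measurable [set y | sw y = 0].
  by apply: measurable_eqr_set => //; exact: m_sw.
have mI : cmeasurable (fun y => (\1_[set y | sw y = 0] y)%:C%C : R[i]).
  exact: cmeasurableR.
have I0 : {ae mu, forall y, sw y != 0 ->
    (\1_[set y | sw y = 0] y)%:C%C = 0 :> R[i]}.
  by apply: aeW => y /eqP sw0; rewrite indicE memNset.
apply: filterS2 w_neq0 ((wcomp_eq0 mI).2 I0) => x wx /eqP.
rewrite mulf_eq0 (negbTE wx)/= indicE; apply: contraTneq => sw0.
by rewrite mem_set//= eq_complex /= oner_eq0.
Qed.

(** Take for test function the conjugate of s cut off to the set where
sw = 0. Its composition with phi is almost everywhere 0, so that the integral
of |s|^2 over this set is 0. *)
Lemma density_null : {ae mu, forall y, sw y = 0 -> s y = 0}.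
Proof.
have [ms h] := sP; pose k := null_part s.
have mk : cmeasurable k by exact: cmeasurable_null_part.
have mr : cmeasurable (fun x => L2_fun f x * (w x)^*).
  by apply: cmeasurableM; [exact: cmeasurable_L2|exact: cmeasurable_conj].
have k0 : {ae mu, forall x, k (phi x) = 0}.
  by apply: filterS phi_notin_null => x /negbTE; rewrite /k null_partE => ->.
have mkc := cmeasurable_conj mk.
have [|i e] := h _ mkc.
  have mF : measurable_fun setT (fun x => normc (L2_fun f x * (w x)^*) * normc (k (phi x))^*).
    by apply: measurable_funM; apply: measurable_normc => //; exact: cmeasurable_comp mkc.
  apply/integrableP; split; first exact/measurable_EFinP.
  rewrite (_ : (\int[mu]_x _)%E = 0%E)//; rewrite -[RHS](integral0 mu setT).
  apply: ge0_ae_eq_integral => //; first by apply: measurableT_comp => //; exact/measurable_EFinP.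
  by apply: filterS k0 => x -> _; rewrite rmorph0 Normc.normc0 mulr0 abse0.
have kE : (fun y => s y * (k y)^* ) = (fun y => (normc (k y) ^+ 2)%:C%C).
  apply/funext => y; rewrite -mul_conj /k null_partE; case: ifP => // _.
  by rewrite rmorph0 !mulr0.
rewrite kE in i e.
have : {ae mu, forall y, normc (k y) ^+ 2 = 0}.
  apply: cintegral0_ae0 => //; first by move=> y; exact: sqr_ge0.
  rewrite -e; transitivity (cintegral mu setT (cst 0 : X -> R[i])).
    apply: cintegral_ae_eq.
    - by apply: cmeasurableM => //; exact: cmeasurable_comp mkc.
    - exact: cmeasurable_cst.
    - by apply: filterS k0 => x ->; rewrite rmorph0 mulr0.
  by rewrite /cintegral !Rintegral_cst// !mul0r.
apply: filterS => y /eqP; rewrite sqrf_eq0 => /eqP/Normc.eq0_normc.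
by rewrite /k null_partE => h0 sw0; move: h0; rewrite sw0 eqxx.
Qed.

(** As s = sw u almost everywhere, f and w (u o phi) have the same inner
products with the range of T; here w (u o phi) is not yet known to be square
integrable. *)
Lemma dagger_dot (g : X -> R[i]) (p : L2 mu) : cmeasurable g ->
  {ae mu, forall x, p x = w x * g (phi x)} ->
  L2dot mu f p = cintegral mu setT (fun y => (sw y)%:C%C * (u y * (g y)^*)).
Proof.
move=> mg pE; have [ms h] := sP; have mgc := cmeasurable_conj mg.
have mf := cmeasurable_L2 f.
have [|i e] := h _ mgc.
  apply: eq_integrable (integrable_normM mf (mwc mg) (L2_lty f) (L2_ae_lty (mwc mg) pE)) => //.
  by move=> x _; rewrite !Normc.normcM !normc_conj mulrA.
transitivity (cintegral mu setT (fun y => s y * (g y)^*)).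
  rewrite -e; apply: cintegral_ae_eq.
  - exact: cmeasurableM mf (cmeasurable_conj (cmeasurable_L2 p)).
  - apply: cmeasurableM; last exact: cmeasurable_comp mgc.
    by apply: cmeasurableM => //; exact: cmeasurable_conj.
  - by apply: filterS pE => x ->; rewrite rmorphM mulrA.
apply: cintegral_ae_eq.
- exact: cmeasurableM.
- apply: cmeasurableM; first by apply: cmeasurableR; exact: m_sw.
  by apply: cmeasurableM => //; exact: cmeasurable_dagger_value.
- apply: filterS density_null => y s0; rewrite mulrA; congr (_ * _).
  rewrite /u mulrCA -rmorphM /=; have [/s0 ->|sw0] := eqVneq (sw y) 0.
    by rewrite mul0r.
  by rewrite mulfV// mulr1.
Qed.

Lemma trunc_conj (v : X -> R[i]) n y :
  v y * (trunc v n y)^* = trunc v n y * (trunc v n y)^*.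
Proof.
have [h|h] := pselect (trunc_set v n y); first by rewrite trunc_in.
by rewrite trunc_notin// rmorph0 !mulr0.
Qed.

(** With q the image under T of a truncation of u, the inner products of f
and of q with q coincide, so f - q is orthogonal to q and |q| <= |f|. *)
Lemma dagger_trunc_le n :
  (\int[mu]_y (sw y * normc (trunc u n y) ^+ 2)%:E <=
   \int[mu]_x (normc (f x) ^+ 2)%:E)%E.
Proof.
have m_u := cmeasurable_dagger_value.
have mt := cmeasurable_trunc n m_u.
have [un [q [_ qE]]] := ex_trunc n m_u.
have [_ qq] := wcomp_dot mt mt qE qE.
(* u and its truncation agree wherever the latter is nonzero *)
have fq : L2dot mu f q = L2dot mu q q.
  rewrite (dagger_dot mt qE) qq; congr (cintegral _ _ _); apply/funext => y.
  by rewrite trunc_conj.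
have qf : L2dot mu q f = L2dot mu q q.
  by rewrite (dotC (L2dot mu) q f)/= fq -(dotC (L2dot mu) q q).
have := dnorm_ge0 (L2dot mu) (f - q).
rewrite linearBl 2!linearBr/= qf fq subrr subr0.
rewrite subr_ge0 !L2dotE lecR -wcomp_norm// => le_qf.
have fin (v : L2 mu) := integrable_fin_num measurableT (L2_integrable v).
rewrite -(ae_eq_L2_integral (cmeasurable_L2 q) (mwc mt) qE).
by rewrite -[leLHS]fineK// -[leRHS]fineK// lee_fin.
Qed.

Lemma dagger_in_L2 : exists q : L2 mu, {ae mu, forall x, q x = w x * u (phi x)}.
Proof.
have m_u := cmeasurable_dagger_value.
apply: ex_L2; first exact: mwc.
apply: le_lt_trans (L2_lty f); rewrite wcomp_norm//.
have mt n : measurable_fun setT (fun y => (sw y * normc (trunc u n y) ^+ 2)%:E).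
  apply/measurable_EFinP/measurable_funM; first exact: m_sw.
  by apply: measurable_sqr_normc; exact: cmeasurable_trunc.
have t0 n y : (0 <= (sw y * normc (trunc u n y) ^+ 2)%:E)%E.
  by rewrite lee_fin mulr_ge0 ?sw_ge0 ?sqr_ge0.
have nd y : {homo (fun n => (sw y * normc (trunc u n y) ^+ 2)%:E) :
    n m / (n <= m)%N >-> (n <= m)%E}.
  move=> n m nm; rewrite lee_fin ler_wpM2l ?sw_ge0//.
  have [h|h] := pselect (trunc_set u n y).
    by rewrite !trunc_in//; exact: trunc_set_nd h.
  by rewrite trunc_notin// Normc.normc0 expr0n sqr_ge0.
rewrite (_ : (\int[mu]_y _)%E = (\int[mu]_y
    limn (fun n => (sw y * normc (trunc u n y) ^+ 2)%:E))%E); last first.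
  apply: eq_integral => y _; apply/esym/lim_near_cst => //.
  by apply: filterS (trunc_set_cover u y) => n h; rewrite trunc_in.
rewrite monotone_convergence//; apply: lime_le; last first.
  by apply: nearW => n; exact: dagger_trunc_le.
by apply: ereal_nondecreasing_is_cvgn => n m nm; apply: ge0_le_integral => // y _; exact: nd.
Qed.

Variable q : L2 mu.
Hypothesis qE : {ae mu, forall x, q x = w x * u (phi x)}.

Lemma dagger_perp : perp (op_range T) (f - q).
Proof.
move=> p [g Tgp]; rewrite linearBl/=.
have m_u := cmeasurable_dagger_value; have mg := cmeasurable_L2 g.
have [_ ->] := wcomp_dot m_u mg qE Tgp.
by rewrite (dagger_dot mg Tgp) subrr.
Qed.

(** By dominated convergence q is the limit of the images of the truncations
of u. Together with [dagger_perp], q is the orthogonal projection of f onto the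
closure of the range. *)
Lemma dagger_closure : norm_closure (L2dot mu) (op_range T) q.
Proof.
have m_u := cmeasurable_dagger_value.
move=> e e0; have [eE er] : e = (complex.Re e)%:C%C /\ 0 < complex.Re e.
  move: e0; rewrite ltcE => /andP[/eqP/= ei er]; split=> //.
  by apply/eqP; rewrite eq_complex /= eqxx ei eqxx.
pose F n y := sw y * normc (u y - trunc u n y) ^+ 2.
have mut n : cmeasurable (fun y => u y - trunc u n y).
  rewrite (_ : (fun _ => _) = u \+ (fun y => -1 * trunc u n y)).
    apply: cmeasurableD => //; apply: cmeasurableZ; exact: cmeasurable_trunc.
  by apply/funext => y /=; rewrite mulN1r.
have mF n : measurable_fun setT (fun y => (F n y)%:E).
  by apply/measurable_EFinP/measurable_funM; [exact: m_sw|exact: measurable_sqr_normc].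
have F0 n y : 0 <= F n y by rewrite mulr_ge0 ?sw_ge0 ?sqr_ge0.
have ig : mu.-integrable setT (fun y => (sw y * normc (u y) ^+ 2)%:E).
  apply/integrableP; split.
    by apply/measurable_EFinP/measurable_funM; [exact: m_sw|exact: measurable_sqr_normc].
  rewrite (eq_integral (fun y => (sw y * normc (u y) ^+ 2)%:E)); last first.
    by move=> y _; rewrite gee0_abs// lee_fin mulr_ge0 ?sw_ge0 ?sqr_ge0.
  by rewrite -wcomp_norm//; exact: L2_ae_lty (mwc m_u) qE.
have [|||_ _] := @dominated_convergence _ _ _ mu _ measurableT
    (fun n y => (F n y)%:E) (cst 0%E) _ mF _ _ ig.
- exact: measurable_cst.
- apply: aeW => y _; apply: cvg_near_cst.
  apply: filterS (trunc_set_cover u y) => n h.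
  by rewrite /F trunc_in// subrr Normc.normc0 expr0n mulr0.
- apply: aeW => y n _; rewrite gee0_abs ?lee_fin// ler_wpM2l ?sw_ge0//.
  have [h|h] := pselect (trunc_set u n y).
    by rewrite trunc_in// subrr Normc.normc0 expr0n sqr_ge0.
  by rewrite trunc_notin// subr0.
rewrite integral0 => cvF.
have : \forall n \near \oo, (\int[mu]_y (F n y)%:E < ((complex.Re e) ^+ 2)%:E)%E.
  have : nbhs (0%E : \bar R) [set z | (z < ((complex.Re e) ^+ 2)%:E)%E].
    by apply: open_nbhs_nbhs; split; [exact: open_ereal_lt_ereal|rewrite /= lte_fin exprn_gt0].
  by move=> /cvF.
move=> [n _ /(_ n (leqnn n))] Fn.
have [un [qn [unE qnE]]] := ex_trunc n m_u.
exists qn.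
  by exists un; apply: filterS2 qnE (ae_comp mphi ac unE) => x /= -> ->.
rewrite eE L2dot_lt; apply: le_lt_trans Fn.
rewrite -(wcomp_norm (mut n)).
rewrite (ae_eq_L2_integral (cmeasurable_L2 (q - qn)) (mwc (mut n)))//.
apply: filterS2 (filterI qE qnE) (L2BE q qn) => x [-> ->] ->.
by rewrite mulrBr.
Qed.

(** If (f, g) is in the Moore-Penrose relation, then q and T g are both
projections of f, and q - T g = w ((u - g) o phi) is orthogonal to the range.
Testing it against the images of the truncations of u - g gives
sw |u - g|^2 = 0. Where sw = 0, both u and g vanish. *)
Lemma moore_penrose_dagger (g : L2 mu) :
  moore_penrose (L2dot mu) T (f, g) <-> {ae mu, forall y, u y = g y}.
Proof.
have m_u := cmeasurable_dagger_value; have mg := cmeasurable_L2 g.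
have u0 y : sw y = 0 -> u y = 0 by move=> sw0; rewrite /u sw0 invr0 mulr0.
split=> [[/= /wcomp_perp_kerP g0 [p Tgp fp]]|ug]; last first.
  split=> /=.
    by apply/wcomp_perp_kerP; apply: filterS ug => y <-; exact: u0.
  exists q; last exact: dagger_perp.
  by apply: filterS2 qE (ae_comp mphi ac ug) => x /= -> ->.
pose v y := u y - g y.
have mv : cmeasurable v.
  rewrite (_ : v = u \+ (fun y => -1 * g y)).
    by apply: cmeasurableD => //; exact: cmeasurableZ.
  by apply/funext => y /=; rewrite mulN1r.
have qpE : {ae mu, forall x, (q - p : L2 mu) x = w x * v (phi x)}.
  by apply: filterS2 (filterI qE Tgp) (L2BE q p) => x [-> /= ->] ->; rewrite -mulrBr.
have qp : perp (op_range T) (q - p).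
  have -> : q - p = (f - p) - (f - q) by rewrite opprB [RHS]addrC addrA subrK.
  by apply: orthocompB => //; exact: dagger_perp.
have v0 n : {ae mu, forall y, sw y * normc (trunc v n y) ^+ 2 = 0}.
  have [vn [pn [vnE pnE]]] := ex_trunc n mv.
  have [i e] := wcomp_dot mv (cmeasurable_trunc n mv) qpE pnE.
  have E : (fun y => (sw y)%:C%C * (v y * (trunc v n y)^*)) =
      (fun y => (sw y * normc (trunc v n y) ^+ 2)%:C%C).
    by apply/funext => y; rewrite trunc_conj mul_conj -rmorphM.
  rewrite E in i e; apply: cintegral0_ae0 => //.
    by move=> y; rewrite mulr_ge0 ?sw_ge0 ?sqr_ge0.
  rewrite -e; apply: qp; exists vn.
  by apply: filterS2 pnE (ae_comp mphi ac vnE) => x /= -> ->.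
have : {ae mu, forall y, forall n, sw y * normc (trunc v n y) ^+ 2 = 0}.
  exact/ae_foralln.
apply: filterS2 g0 => y g0 {}v0; have [sw0|sw0] := eqVneq (sw y) 0.
  by rewrite u0// g0.
have [n _ /(_ n (leqnn n)) vn] := trunc_set_cover v y.
have := v0 n; rewrite trunc_in// => /eqP; rewrite mulf_eq0 (negbTE sw0) sqrf_eq0.
by move=> /eqP/Normc.eq0_normc/eqP; rewrite subr_eq0 => /eqP.
Qed.
End reciprocal_value.

Lemma ex_product_density (f : L2 mu) :
  exists s, complex_density mu mu phi (fun x => f x * (w x)^*) s.
Proof.
have mf := cmeasurable_L2 f.
apply: (ex_complex_density mphi ac mB BT).
  by apply: cmeasurableM => //; exact: cmeasurable_conj.
move=> n; have /integrableP[_] := integrable_conj_on f (mph (mB n)) mw (wB n).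
apply: le_lt_trans; rewrite integral_mkcond epatch_indic.
rewrite le_eqVlt; apply/orP; left; apply/eqP; apply: eq_integral => x _.
rewrite EFinM gee0_abs// mule_ge0// lee_fin ?normc_ge0//.
Qed.

(** Each f is q + (f - q), with q in the closure of the range and f - q
orthogonal to the range. *)
Lemma wcomp_range_dense :
  norm_dense (L2dot mu) (subspace_sum (op_range T) (perp (op_range T))).
Proof.
apply/seteqP; split => // f _ e e0.
have [s sP] := ex_product_density f; have [q qE] := dagger_in_L2 sP.
have [g Tg gq] := dagger_closure sP qE e0.
exists (g + (f - q)).
  by exists g; [exact: Tg|exists (f - q); [exact: (dagger_perp sP qE)|]].
rewrite (_ : f - (g + (f - q)) = q - g)//.
by rewrite opprD opprB addrCA [in RHS]addrC; congr (_ + _); rewrite addrC subrK.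
Qed.

Lemma reciprocal_wcompP (f g : L2 mu) (s : X -> R[i]) :
  complex_density mu mu phi (fun x => f x * (w x)^*) s ->
  reciprocal (L2dot mu) T (f, g) <-> {ae mu, forall y, dagger_value s y = g y}.
Proof.
move=> sP; have [q qE] := dagger_in_L2 sP.
rewrite reciprocal_moore_penrose; first exact (moore_penrose_dagger sP qE g).
- exact: wcomp_linear.
- exact: wcomp_kernel_decomposition.
- exact: wcomp_range_dense.
Qed.
End wcomp_theory.

(** * Uniqueness from integrals over few sets *)

Section uniqueness.
Context {d} {X : measurableType d} {R : realType}.
Variable mu : {measure set X -> \bar R}.

Lemma integral_eq_lt_null (F1 F2 : X -> \bar R) (E : set X) : measurable E ->
  mu.-integrable E F1 -> mu.-integrable E F2 ->
  (forall x, E x -> F1 x < F2 x)%E ->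
  (\int[mu]_(x in E) F1 x = \int[mu]_(x in E) F2 x)%E -> (mu E = 0)%E.
Proof.
move=> mE i1 i2 lt12 e12; have i21 := integrableB mE i2 i1.
have : (\int[mu]_(x in E) `|(F2 \- F1) x| = 0)%E.
  rewrite (eq_integral (F2 \- F1)%E); last first.
    by move=> x; rewrite inE => Ex; rewrite gee0_abs//= ltW// sube_gt0 lt12.
  by rewrite integralB// e12 subee//; exact: integrable_fin_num.
move=> /(ae_eq_integral_abs mu mE (measurable_int _ i21)) [N [mN N0 EN]].
apply: (subset_measure0 mE mN _ N0) => x Ex; apply: EN => /= /(_ Ex)/eqP.
by rewrite gt_eqF// sube_gt0 lt12.
Qed.

(** The hypothesis tests only the sets where one function is less than the
other, cut along a cover. These are available even when both functions are
measurable for a smaller sigma-algebra and the integrals are only known to agree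
on that one. *)
Lemma ae_eq_of_integral (F1 F2 : X -> \bar R) (C : (set X)^nat) :
  \bigcup_n C n = setT ->
  (forall n, measurable (C n `&` [set x | F1 x < F2 x]%E)) ->
  (forall n, measurable (C n `&` [set x | F2 x < F1 x]%E)) ->
  (forall n E, (E = C n `&` [set x | F1 x < F2 x]%E) \/
               (E = C n `&` [set x | F2 x < F1 x]%E) ->
     [/\ mu.-integrable E F1, mu.-integrable E F2 &
      \int[mu]_(x in E) F1 x = \int[mu]_(x in E) F2 x]%E) ->
  {ae mu, forall x, F1 x = F2 x}.
Proof.
move=> CT m1 m2 H.
have n1 n : mu.-negligible (C n `&` [set x | F1 x < F2 x]%E).
  apply/negligibleP => //; have [i1 i2 e] := H n _ (or_introl erefl).
  by apply: (integral_eq_lt_null _ i1 i2 _ e) => // x [].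
have n2 n : mu.-negligible (C n `&` [set x | F2 x < F1 x]%E).
  apply/negligibleP => //; have [i1 i2 e] := H n _ (or_intror erefl).
  by apply: (integral_eq_lt_null _ i2 i1 _ (esym e)) => // x [].
have := negligibleU (negligible_bigcup n1) (negligible_bigcup n2).
apply: negligibleS => x /= /eqP; rewrite neq_lt.
have [n _ Cx] : (\bigcup_n C n) x by rewrite CT.
by move=> /orP[]h; [left|right]; exists n.
Qed.
End uniqueness.

Section preimage_algebra.
Context {d d'} {X : measurableType d} {Y : measurableType d'}.
Variable phi : X -> Y.

Lemma measurable_preimageP (E : set X) :
  measurable (E : set (g_sigma_algebra_preimageType phi)) <->
  exists2 A, measurable A & E = phi @^-1` A.
Proof.
split=> [[A mA <-]|[A mA ->]]; first by exists A => //; rewrite setTI.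
by exists A => //; rewrite setTI.
Qed.

Lemma measurable_comp_preimage {d3} {Z : measurableType d3} (g : Y -> Z) :
  measurable_fun setT g ->
  measurable_fun setT (g \o phi : g_sigma_algebra_preimageType phi -> Z).
Proof.
move=> mg _ A mA; apply/measurable_preimageP; exists (g @^-1` A); last by rewrite setTI.
exact: measurable_preimage mA.
Qed.
End preimage_algebra.

Section cintegral_restriction.
Context {d} {X : measurableType d} {R : realType}.
Variable mu : {measure set X -> \bar R}.

Lemma cintegral_mkcond (D : set X) (f : X -> R[i]) :
  cintegral mu D f = cintegral mu setT (fun x => f x * (\1_D x)%:C%C).
Proof.
rewrite /cintegral; congr Complex; rewrite Rintegral_mkcond; apply: eq_Rintegral => x _;
  by rewrite patch_indic /= ?ReM ?ImM /= mulr0 ?subr0 ?add0r.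
Qed.

Lemma cintegrable_mkcond (D : set X) (f : X -> R[i]) : measurable D ->
  cintegrable mu D f <-> cintegrable mu setT (fun x => f x * (\1_D x)%:C%C).
Proof.
move=> mD; split=> -[i1 i2]; split.
- move: i1 => /(integrable_mkcond _ mD).1; apply: eq_integrable => // x _.
  by rewrite epatch_indic /= ReM /= mulr0 subr0.
- move: i2 => /(integrable_mkcond _ mD).1; apply: eq_integrable => // x _.
  by rewrite epatch_indic /= ImM /= mulr0 add0r.
- apply/(integrable_mkcond _ mD); move: i1; apply: eq_integrable => // x _.
  by rewrite epatch_indic /= ReM /= mulr0 subr0.
- apply/(integrable_mkcond _ mD); move: i2; apply: eq_integrable => // x _.
  by rewrite epatch_indic /= ImM /= mulr0 add0r.
Qed.
End cintegral_restriction.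

(** * Conditional expectations as quotients of densities *)

Section formula.
Context {d} {X : measurableType d} {R : realType}.
Variable mu : {sigma_finite_measure set X -> \bar R}.
Variables (phi : X -> X) (w : X -> R[i]).
Hypothesis mphi : measurable_fun setT phi.
Hypothesis mw : cmeasurable w.
Hypothesis ac : forall A, measurable A -> (mu A = 0 -> mu (phi @^-1` A) = 0)%E.
Local Notation normc := (@Normc.normc R).
Variables (h sw : X -> R).
Hypothesis hP : pushforward_density mu mu phi (cst 1) h.
Hypothesis swP : pushforward_density mu mu phi (fun x => normc (w x) ^+ 2) sw.
Local Notation h_ge0 := (let: And3 _ p _ := hP in p).
Local Notation m_h := (let: And3 p _ _ := hP in p).
Local Notation hE := (let: And3 _ _ p := hP in p).
Local Notation sw_ge0 := (let: And3 _ p _ := swP in p).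
Local Notation m_sw := (let: And3 p _ _ := swP in p).
Local Notation swE := (let: And3 _ _ p := swP in p).
Variable B : (set X)^nat.
Hypothesis mB : forall n, measurable (B n).
Hypothesis BT : \bigcup_n B n = setT.
Hypothesis phiB : forall n, (mu (phi @^-1` B n) < +oo)%E.
Hypothesis w_lty : forall A, measurable A -> (mu (phi @^-1` A) < +oo)%E ->
  (\int[mu]_(x in phi @^-1` A) (normc (w x) ^+ 2)%:E < +oo)%E.

Let mph A : measurable A -> measurable (phi @^-1` A).
Proof. exact: measurable_preimage. Qed.

Lemma density_set (r s : X -> R) (A : set X) : pushforward_density mu mu phi r s ->
  measurable A ->
  (\int[mu]_(x in phi @^-1` A) (r x)%:E = \int[mu]_(y in A) (s y)%:E)%E.
Proof.
move=> [ms s0 rs] mA.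
rewrite integral_mkcond [in RHS]integral_mkcond !epatch_indic.
apply: (rs (EFin \o \1_A)).
  exact/measurable_EFinP.
by move=> y; rewrite lee_fin indicE; case: (_ \in _).
Qed.

Lemma mu_preimage (A : set X) : measurable A ->
  (mu (phi @^-1` A) = \int[mu]_(y in A) (h y)%:E)%E.
Proof.
move=> mA; rewrite -(density_set hP mA).
by rewrite -[RHS]/(\int[mu]_(x in phi @^-1` A) cst 1%E x)%E integral_cst ?mul1e//; exact: mph.
Qed.

Lemma hderivE : {ae mu, forall x, hderiv mu phi x = (h x)%:E}.
Proof.
rewrite /hderiv; set P := (P in xget _ P).
have [mH H0 HE] : P (xget (cst 0%E) P).
  apply: xgetPex; exists (EFin \o h); split.
  - by apply/measurable_EFinP; exact: m_h.
  - by move=> x; rewrite lee_fin h_ge0.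
  - by move=> A mA; exact: mu_preimage.
move: (xget _ _) mH H0 HE => H mH H0 HE.
have mh : measurable_fun setT (EFin \o h) by apply/measurable_EFinP; exact: m_h.
have m1 : measurable [set x | (H x < (h x)%:E)%E].
  by rewrite -[X in measurable X]setTI; exact: measurable_lte.
have m2 : measurable [set x | ((h x)%:E < H x)%E].
  by rewrite -[X in measurable X]setTI; exact: measurable_lte.
apply: (ae_eq_of_integral (F2 := EFin \o h) BT) => [n|n|n E EB]; try exact: measurableI.
have [mE EBn] : measurable E /\ E `<=` B n.
  by case: EB => ->; split; [exact: measurableI|by move=> x []|exact: measurableI|by move=> x []].
have Eoo : (mu (phi @^-1` E) < +oo)%E.
  apply: le_lt_trans (phiB n); apply: le_measure; rewrite ?inE; [exact: mph|exact: mph|].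
  by move=> x /EBn.
split; last by transitivity (mu (phi @^-1` E)); [exact/esym/HE|exact: mu_preimage].
- apply/integrableP; split; first exact: measurable_funTS.
  by under eq_integral do rewrite gee0_abs//; rewrite -HE//; exact: Eoo.
- apply/integrableP; split; first exact: measurable_funTS.
  rewrite (eq_integral (fun y => (h y)%:E)); first by rewrite -mu_preimage.
  by move=> x _; rewrite gee0_abs//= lee_fin h_ge0.
Qed.

(** If the preimage of N is null, then the integral of h over N is 0. *)
Lemma ae_preimage_null (N : set X) : measurable N -> {ae mu, forall x, ~ N (phi x)} ->
  {ae mu, forall y, h y != 0 -> ~ N y}.
Proof.
move=> mN NN.
have N0 : mu (phi @^-1` N) = 0%E.
  apply/negligibleP; first exact: mph.
  by apply: negligibleS NN => x /= Nx; exact.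
have : {ae mu, forall y, h y * \1_N y = 0}.
  apply: integral0_ae0.
  - by apply: measurable_funM; [exact: m_h|exact: measurable_indic].
  - by move=> y; rewrite mulr_ge0 ?h_ge0// indicE; case: (_ \in _).
  - transitivity (mu (phi @^-1` N)); last exact: N0.
    rewrite mu_preimage// [RHS]integral_mkcond epatch_indic.
    by apply: eq_integral => y _; rewrite EFinM.
apply: filterS => y /eqP + h0 Ny; rewrite mulf_eq0 (negbTE h0) indicE mem_set//=.
by rewrite oner_eq0.
Qed.

(** The image of r mu is absolutely continuous with respect to the image of
mu. *)
Lemma density_h_null (r s : X -> R) : measurable_fun setT r ->
  pushforward_density mu mu phi r s -> {ae mu, forall y, h y = 0 -> s y = 0}.
Proof.
move=> mr rs; have [ms s0 _] := rs.
pose Z := [set y | h y = 0].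
have mZ : measurable Z by apply: measurable_eqr_set => //; exact: m_h.
have Z0 : mu (phi @^-1` Z) = 0%E.
  rewrite mu_preimage//; rewrite -[RHS](integral0 mu Z).
  by apply: eq_integral => y; rewrite inE /Z /= => ->.
have : {ae mu, forall y, s y * \1_Z y = 0}.
  apply: integral0_ae0.
  - exact: measurable_funM.
  - by move=> y; rewrite mulr_ge0// indicE; case: (_ \in _).
  - transitivity (\int[mu]_(y in Z) (s y)%:E)%E.
      by rewrite [RHS]integral_mkcond epatch_indic; apply: eq_integral => y _; rewrite EFinM.
    rewrite -(density_set rs mZ).
    by apply: null_set_integral; [exact: mph|exact/measurable_EFinP/measurable_funTS|].
apply: filterS => y /eqP + h0; rewrite mulf_eq0 indicE mem_set//= oner_eq0 orbF.
by move/eqP.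
Qed.

Let k y := sw y / h y.

Let m_k : measurable_fun setT k.
Proof.
apply: measurable_funM; first exact: m_sw.
by apply: measurable_inv_ge0; [exact: m_h|exact: h_ge0].
Qed.

Let k_ge0 y : 0 <= k y.
Proof. by rewrite mulr_ge0 ?sw_ge0// invr_ge0 h_ge0. Qed.

Let sw_h_null : {ae mu, forall y, h y = 0 -> sw y = 0}.
Proof. by apply: density_h_null swP; exact: measurable_sqr_normc. Qed.

(** The function k = sw / h satisfies h k = sw almost everywhere because sw
vanishes with h. *)
Lemma condexp_ge0_witness A : measurable A ->
  (\int[mu]_(x in phi @^-1` A) (k (phi x))%:E =
   \int[mu]_(x in phi @^-1` A) (normc (w x) ^+ 2)%:E)%E.
Proof.
move=> mA; rewrite (density_set swP mA).
transitivity (\int[mu]_(y in A) (h y * k y)%:E)%E; last first.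
  apply: ge0_ae_eq_integral => //.
  - by apply/measurable_EFinP/measurable_funTS/measurable_funM => //; exact: m_h.
  - by apply/measurable_EFinP/measurable_funTS; exact: m_sw.
  - by move=> y _; rewrite lee_fin mulr_ge0// h_ge0.
  - by move=> y _; rewrite lee_fin sw_ge0.
  - apply: filterS sw_h_null => y s0 _; congr EFin.
    have [h0|h0] := eqVneq (h y) 0; first by rewrite h0 mul0r s0.
    by rewrite mulrC divfK.
rewrite [LHS]integral_mkcond [RHS]integral_mkcond !epatch_indic.
transitivity (\int[mu]_x ((cst 1 x)%:E * ((k (phi x))%:E * (\1_A (phi x))%:E)))%E.
  by apply: eq_integral => x _; rewrite mul1e.
rewrite (hE (fun y => (k y)%:E * (\1_A y)%:E)%E).
- by apply: eq_integral => y _; rewrite EFinM muleA.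
- by apply: emeasurable_funM; apply/measurable_EFinP.
- by move=> y; rewrite -EFinM lee_fin mulr_ge0// indicE; case: (_ \in _).
Qed.

Let W x := ((normc (w x)) ^+ 2)%:E.

(** Uniqueness of conditional expectations: mu is sigma-finite on the
sigma-algebra of preimages, as the preimages of the sets B n have finite
measure. *)
Lemma ae_eq_preimage (F1 F2 : g_sigma_algebra_preimageType phi -> \bar R) :
  measurable_fun setT F1 -> measurable_fun setT F2 ->
  (forall A, measurable A -> (mu (phi @^-1` A) < +oo)%E ->
    [/\ mu.-integrable (phi @^-1` A) F1, mu.-integrable (phi @^-1` A) F2 &
      \int[mu]_(x in phi @^-1` A) F1 x = \int[mu]_(x in phi @^-1` A) F2 x]%E) ->
  {ae mu, forall x : X, F1 x = F2 x}.
Proof.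
move=> m1 m2 F12.
have mC n : measurable (phi @^-1` B n : set (g_sigma_algebra_preimageType phi)).
  by apply/measurable_preimageP; exists (B n).
have mX (E : set X) : measurable (E : set (g_sigma_algebra_preimageType phi)) -> measurable E.
  by move=> /measurable_preimageP[A mA ->]; exact: mph.
have mlt n (G1 G2 : g_sigma_algebra_preimageType phi -> \bar R) :
    measurable_fun setT G1 -> measurable_fun setT G2 ->
    measurable (phi @^-1` B n `&` [set x | (G1 x < G2 x)%E] :
      set (g_sigma_algebra_preimageType phi)).
  move=> mG1 mG2; apply: measurableI => //.
  by rewrite -[X in measurable X]setTI; exact: measurable_lte.
apply: (@ae_eq_of_integral _ _ _ _ _ _ (fun n => phi @^-1` B n)) => [|n|n|n E EB].
- by rewrite -preimage_bigcup BT preimage_setT.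
- exact/mX/mlt.
- exact/mX/mlt.
have [/measurable_preimageP[A mA EA] EBn] :
    measurable (E : set (g_sigma_algebra_preimageType phi)) /\ E `<=` phi @^-1` B n.
  by case: EB => ->; split; [exact: mlt|by move=> x []|exact: mlt|by move=> x []].
rewrite EA; apply: F12 => //; apply: le_lt_trans (phiB n).
by apply: le_measure; rewrite ?inE; [exact: mph|exact: mph|rewrite -EA].
Qed.

Lemma condexp_ge0E : {ae mu, forall x, condexp_ge0 mu phi W x = (k (phi x))%:E}.
Proof.
have mkphi : measurable_fun setT
    ((fun x => (k (phi x))%:E) : g_sigma_algebra_preimageType phi -> \bar R).
  apply: (@measurable_comp_preimage _ _ _ _ phi _ _ (EFin \o k)).
  exact/measurable_EFinP.
rewrite /condexp_ge0; set P := (P in xget _ P).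
have [mK K0 KE] : P (xget (cst 0%E) P).
  apply: xgetPex; exists (fun x => (k (phi x))%:E); split => // [x|].
    by rewrite lee_fin k_ge0.
  exact: condexp_ge0_witness.
move: (xget _ _) mK K0 KE => K mK K0 KE.
have int (F : X -> \bar R) A :
    measurable_fun setT (F : g_sigma_algebra_preimageType phi -> \bar R) ->
    (forall x, 0 <= F x)%E ->
    (\int[mu]_(x in phi @^-1` A) F x = \int[mu]_(x in phi @^-1` A) W x)%E ->
    measurable A -> (mu (phi @^-1` A) < +oo)%E -> mu.-integrable (phi @^-1` A) F.
  move=> mF F0 FW mA Aoo; apply/integrableP; split.
    apply: measurable_funTS => _ Y mY; have := mF measurableT Y mY.
    by move=> /measurable_preimageP[A' mA' ->]; exact: mph.
  rewrite (eq_integral F); first by rewrite FW; exact: w_lty.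
  by move=> x _; rewrite gee0_abs.
apply: ae_eq_preimage => // A mA Aoo; split.
- by apply: int => //; exact: KE.
- apply: int => //; first by move=> x; rewrite lee_fin k_ge0.
  exact: condexp_ge0_witness.
- by rewrite KE// condexp_ge0_witness.
Qed.

(** Composition with phi determines a function only where h <> 0, by
[ae_preimage_null]. Where h = 0, both sides are 0. *)
Lemma condexp_ge0_invE : {ae mu, forall y, condexp_ge0_inv mu phi W y = (k y)%:E}.
Proof.
have k0 : {ae mu, forall y, h y = 0 -> k y = 0}.
  by apply: aeW => y hy0; rewrite /k hy0 invr0 mulr0.
rewrite /condexp_ge0_inv; set P := (P in xget _ P).
have [mG G0 GE] : P (xget (cst 0%E) P).
  apply: xgetPex; exists (EFin \o k); split.
  - exact/measurable_EFinP.
  - by apply: filterS2 hderivE k0 => y -> k0 [] /k0 /= ->.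
  - exact: condexp_ge0E.
move: (xget _ _) mG G0 GE => G mG G0 GE.
have mN : measurable [set y | G y != (k y)%:E].
  rewrite -[X in measurable X]setTI; apply: measurable_neqe => //.
  exact/measurable_EFinP.
have := ae_preimage_null mN; have NN : {ae mu, forall x, ~ (G (phi x) != (k (phi x))%:E)}.
  by apply: filterS2 GE condexp_ge0E => x -> ->; rewrite eqxx.
move=> /(_ NN) GK.
apply: filterS2 (filterI GK G0) (filterI hderivE k0) => y [/= gk g0] [/= hd {}k0].
have [h0|h0] := eqVneq (h y) 0; first by rewrite g0 ?hd ?h0// k0.
by have /negP := gk h0; rewrite negbK => /eqP.
Qed.

Hypothesis w_neq0 : {ae mu, forall x, w x != 0}.
Variables (f : L2 mu) (s : X -> R[i]).
Hypothesis sP : complex_density mu mu phi (fun x => f x * (w x)^*) s.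

Let c y : R[i] := s y * ((h y)^-1)%:C%C.

Let mc : cmeasurable c.
Proof.
apply: cmeasurableM; first exact: sP.1.
by apply: cmeasurableR; apply: measurable_inv_ge0; [exact: m_h|exact: h_ge0].
Qed.

Let s_null : {ae mu, forall y, sw y = 0 -> s y = 0}.
Proof. exact: (density_null mphi mw swP w_neq0 sP). Qed.

(** The integral of (s / h) o phi over the preimage of A is that of
h (s / h) = s over A, hence that of f conj(w) over the preimage of A. *)
Lemma condexp_witness A : measurable A -> (mu (phi @^-1` A) < +oo)%E ->
  cintegrable mu (phi @^-1` A) (fun x => c (phi x)) /\
  cintegral mu (phi @^-1` A) (fun x => c (phi x)) =
  cintegral mu (phi @^-1` A) (fun x => f x * (w x)^*).
Proof.
move=> mA Aoo; have mf := cmeasurable_L2 f; have ms := sP.1.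
have mphA := mph mA.
have mI : cmeasurable (fun y => (\1_A y)%:C%C : R[i]) by exact: cmeasurableR.
have [|i1 e1] := sP.2 _ mI.
  have := integrable_conj_on f mphA mw (w_lty mA Aoo).
  apply: eq_integrable => // x _.
  by rewrite normcR ger0_norm// indicE; case: (_ \in _).
have mcI : cmeasurable (fun y => c y * (\1_A y)%:C%C) by exact: cmeasurableM.
have mN : measurable_fun setT (fun x => normc (c (phi x) * (\1_A (phi x))%:C%C)).
  by apply: measurable_normc; exact: cmeasurable_comp mcI.
have iN : mu.-integrable setT (fun x => (normc (c (phi x) * (\1_A (phi x))%:C%C))%:E).
  apply/integrableP; split; first exact/measurable_EFinP.
  rewrite (eq_integral (fun x =>
    (cst 1 x)%:E * (normc (c (phi x) * (\1_A (phi x))%:C%C))%:E)%E); last first.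
    by move=> x _; rewrite gee0_abs ?lee_fin ?normc_ge0// mul1e.
  rewrite (hE (fun y => (normc (c y * (\1_A y)%:C%C))%:E)); last 2 first.
  - exact/measurable_EFinP/measurable_normc.
  - by move=> y; rewrite lee_fin normc_ge0.
  have msI := cmeasurableM ms mI.
  have /integrableP[_] : mu.-integrable setT (fun y => (`|complex.Re (s y * (\1_A y)%:C%C)| +
      `|complex.Im (s y * (\1_A y)%:C%C)|)%:E).
    have [r1 r2] := i1.
    by have := integrableD measurableT (integrable_norm r1) (integrable_norm r2).
  apply: le_lt_trans; apply: ge0_le_integral => //.
  - by move=> y _; rewrite -EFinM lee_fin mulr_ge0 ?h_ge0 ?normc_ge0.
  - apply: emeasurable_funM; apply/measurable_EFinP; first exact: m_h.
    exact: measurable_normc.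
  - apply: measurableT_comp => //; apply/measurable_EFinP; apply: measurable_funD.
      by apply: measurableT_comp => //; exact: msI.1.
    by apply: measurableT_comp => //; exact: msI.2.
  - move=> y _; rewrite -EFinM lee_fin [leRHS]ger0_norm ?addr_ge0//.
    apply: (@le_trans _ _ (normc (s y * (\1_A y)%:C%C))); last first.
      rewrite [X in normc X]complexE (le_trans (le_normcD _ _))//.
      rewrite Normc.normcM !normcR normcE /= expr0n expr1n add0r sqrtr1 mul1r.
      by [].
    rewrite !Normc.normcM normcR ger0_norm ?invr_ge0 ?h_ge0//.
    rewrite mulrA ler_wpM2r ?normc_ge0// mulrCA.
    have [->|h0] := eqVneq (h y) 0; first by rewrite mul0r mulr0 normc_ge0.
    by rewrite mulfV// mulr1.
have hC : complex_density mu mu phi (fun x => (cst 1 x)%:C%C) (fun y => (h y)%:C%C).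
  by apply: complex_density_ge0.
have [|i2 e2] := hC.2 _ mcI.
  by apply: eq_integrable iN => // x _; rewrite Normc.normc1 mul1r.
split.
  apply/cintegrable_mkcond => //; apply: le_cintegrable iN _ => //.
  exact: cmeasurable_comp mcI.
rewrite [LHS]cintegral_mkcond [RHS]cintegral_mkcond.
transitivity (cintegral mu setT (fun y => s y * (\1_A y)%:C%C)); last exact/esym/e1.
transitivity (cintegral mu setT (fun y => (h y)%:C%C * (c y * (\1_A y)%:C%C))).
  by rewrite -e2; congr (cintegral _ _ _); apply/funext => x; rewrite mul1r.
apply: cintegral_ae_eq.
- by apply: cmeasurableM => //; apply: cmeasurableR; exact: m_h.
- exact: cmeasurableM.
- apply: filterS2 s_null sw_h_null => y s0 sw0; rewrite mulrA; congr (_ * _).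
  rewrite /c mulrCA -rmorphM /=; have [/sw0/s0 ->|h0] := eqVneq (h y) 0.
    by rewrite mul0r.
  by rewrite mulfV// mulr1.
Qed.

Let fw x := f x * (w x)^*.

Lemma condexpE : {ae mu, forall x, condexp mu phi fw x = c (phi x)}.
Proof.
have [c1 c2] := mc.
have mcphi : cmeasurable ((fun x => c (phi x)) : g_sigma_algebra_preimageType phi -> R[i]).
  by split; [exact: (measurable_comp_preimage (g := @complex.Re R \o c))|
    exact: (measurable_comp_preimage (g := @complex.Im R \o c))].
rewrite /condexp; set P := (P in xget _ P).
have [[m1 m2] CE] : P (xget (cst 0) P).
  by apply: xgetPex; exists (fun x => c (phi x)); split => // A mA Aoo; exact: condexp_witness.
move: (xget _ _) m1 m2 CE => C m1 m2 CE; have [p1 p2] := mcphi.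
have Eint (D : set X) (a b : X -> R) :
    mu.-integrable D (EFin \o a) -> mu.-integrable D (EFin \o b) ->
    measurable D ->
    (\int[mu]_(x in D) a x)%R = (\int[mu]_(x in D) b x)%R ->
    (\int[mu]_(x in D) (a x)%:E = \int[mu]_(x in D) (b x)%:E)%E.
  move=> ia ib mD ab; rewrite -[LHS]fineK; last exact: integrable_fin_num.
  by rewrite -[RHS]fineK; [congr EFin|exact: integrable_fin_num].
have re : {ae mu, forall x : X, (complex.Re (C x))%:E = (complex.Re (c (phi x)))%:E}.
  apply: (@ae_eq_preimage (EFin \o (@complex.Re R \o C))
    (EFin \o (@complex.Re R \o (fun x => c (phi x))))).
  - exact/measurable_EFinP.
  - exact/measurable_EFinP.
  - move=> A mA Aoo; have [[i1 i2] e] := CE A mA Aoo.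
    have [[j1 j2] e'] := condexp_witness mA Aoo; split => //.
    apply: Eint => //; first exact: mph.
    by move: e; rewrite -e' => -[].
have im : {ae mu, forall x : X, (complex.Im (C x))%:E = (complex.Im (c (phi x)))%:E}.
  apply: (@ae_eq_preimage (EFin \o (@complex.Im R \o C))
    (EFin \o (@complex.Im R \o (fun x => c (phi x))))).
  - exact/measurable_EFinP.
  - exact/measurable_EFinP.
  - move=> A mA Aoo; have [[i1 i2] e] := CE A mA Aoo.
    have [[j1 j2] e'] := condexp_witness mA Aoo; split => //.
    apply: Eint => //; first exact: mph.
    by move: e; rewrite -e' => -[].
apply: filterS2 re im => x [e1] [e2].
by apply/eqP; rewrite eq_complex e1 e2 !eqxx.
Qed.

Lemma condexp_invE : {ae mu, forall y, condexp_inv mu phi fw y = c y}.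
Proof.
have c0 : {ae mu, forall y, h y = 0 -> c y = 0}.
  by apply: aeW => y hy0; rewrite /c hy0 invr0 mulr0.
rewrite /condexp_inv; set P := (P in xget _ P).
have [[m1 m2] G0 GE] : P (xget (cst 0) P).
  apply: xgetPex; exists c; split => //.
  - by apply: filterS2 hderivE c0 => y -> c0 [] /c0.
  - exact: condexpE.
move: (xget _ _) m1 m2 G0 GE => G m1 m2 G0 GE; have [c1 c2] := mc.
have mN : measurable [set y | G y <> c y].
  rewrite (_ : [set y | _] = ~` ([set y | complex.Re (G y) = complex.Re (c y)] `&`
      [set y | complex.Im (G y) = complex.Im (c y)])).
    by apply: measurableC; apply: measurableI; exact: measurable_eqr_set.
  apply/seteqP; split => y /=; apply: contra_not; last by move=> ->.
  by move=> [e1 e2]; apply/eqP; rewrite eq_complex e1 e2 !eqxx.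
have NN : {ae mu, forall x, ~ (G (phi x) <> c (phi x))}.
  by apply: filterS2 GE condexpE => x -> ->.
have GC := ae_preimage_null mN NN.
apply: filterS2 (filterI GC G0) (filterI hderivE c0) => y [/= gc g0] [/= hd {}c0].
have [h0|h0] := eqVneq (h y) 0; first by rewrite g0 ?hd ?h0// c0.
exact: contrapT (gc h0).
Qed.

(** Where sw = 0, also s = 0, and the formula reads 0 / 0 = 0. Elsewhere h is
nonzero and cancels. *)
Lemma reciprocal_formulaE :
  {ae mu, forall y, reciprocal_formula mu phi w f y = Some (dagger_value sw s y)}.
Proof.
apply: filterS2 (filterI condexp_invE condexp_ge0_invE) (filterI s_null sw_h_null).
move=> y [/= cE kE] [/= s0 sw0]; rewrite /reciprocal_formula cE kE /cdive /dagger_value.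
have [sw_0|sw_n0] := eqVneq (sw y) 0.
  by rewrite /k sw_0 mul0r eqxx /c s0// !mul0r eqxx.
have h_n0 : h y != 0 by apply: contra sw_n0 => /eqP/sw0 ->.
rewrite eqe mulf_eq0 invr_eq0 (negbTE sw_n0) (negbTE h_n0) /=; congr Some.
rewrite /c -mulrA -rmorphM /=; congr (_ * _%:C%C).
by rewrite invf_div mulrA mulVf// mul1r.
Qed.
End formula.

(** * The formula for the reciprocal *)

Theorem proposition8 (d : measure_display) (X : measurableType d)
  (R : realType) (mu : {sigma_finite_measure set X -> \bar R})
  (phi : X -> X) (w : X -> R[i]) (beta : R)
  (phi_meas : measurable_fun [set: X] phi)
  (w_meas : cmeasurable w)
  (Cphi_dense : comp_densely_defined mu phi)
  (Cphiw_dense : wcomp_densely_defined mu phi w)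
  (beta_gt0 : 0 < beta)
  (w_bnd : {ae mu, forall x, 0 < Normc.normc (w x) < beta}) :
  op_dom (reciprocal (L2dot mu) (wcomp mu phi w)) =
    [set f : L2 mu | in_L2 mu (reciprocal_formula mu phi w f)] /\
  forall f g : L2 mu, reciprocal (L2dot mu) (wcomp mu phi w) (f, g) ->
    {ae mu, forall x, reciprocal_formula mu phi w f x = Some (g x)}.
Proof.
have ac := comp_dominated phi_meas Cphi_dense.
have [B [mB ndB BT muB phiB]] := comp_exhaustion phi_meas Cphi_dense.
have mph A := @measurable_preimage _ _ _ _ phi A phi_meas.
have w_neq0 : {ae mu, forall x, w x != 0}.
  apply: filterS w_bnd => x /andP[w0 _]; apply: contraTneq w0 => ->.
  by rewrite Normc.normc0 ltxx.
have m_w2 := measurable_sqr_normc w_meas.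
have w_lty A : measurable A -> (mu (phi @^-1` A) < +oo)%E ->
    (\int[mu]_(x in phi @^-1` A) (Normc.normc (w x) ^+ 2)%:E < +oo)%E.
  move=> mA Aoo.
  apply: (@le_lt_trans _ _ (\int[mu]_(x in phi @^-1` A) cst (beta ^+ 2)%:E x)%E).
    apply: ae_ge0_le_integral => //.
    - exact: mph.
    - by move=> x _; rewrite lee_fin sqr_ge0.
    - exact/measurable_EFinP/measurable_funTS.
    - by move=> x _; rewrite lee_fin sqr_ge0.
    - apply: filterS w_bnd => x /andP[/ltW w0 /ltW wb] _.
      by rewrite lee_fin ler_pXn2r// nnegrE ltW.
  by rewrite integral_cst ?lte_mul_pinfty ?lee_fin ?sqr_ge0//; exact: mph.
have w2_ge0 x : 0 <= Normc.normc (w x) ^+ 2 by exact: sqr_ge0.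
have [h hP] : exists h, pushforward_density mu mu phi (cst 1) h.
  apply: (ex_pushforward_density phi_meas ac mB BT) => // n.
  rewrite -[X in (X < _)%E]/(\int[mu]_(x in phi @^-1` B n) cst 1%E x)%E.
  by rewrite integral_cst ?mul1e; [exact: phiB|exact: mph].
have [sw swP] : exists s, pushforward_density mu mu phi (fun x => Normc.normc (w x) ^+ 2) s.
  by apply: (ex_pushforward_density phi_meas ac mB BT) => // n; exact: w_lty.
have wB n := w_lty (B n) (mB n) (phiB n).
have key (f g : L2 mu) : reciprocal (L2dot mu) (wcomp mu phi w) (f, g) <->
    {ae mu, forall x, reciprocal_formula mu phi w f x = Some (g x)}.
  have [s sP] := ex_product_density phi_meas w_meas ac mB BT wB f.
  rewrite (reciprocal_wcompP phi_meas w_meas ac swP w_neq0 mB ndB BT muB wB g sP).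
  have formE := reciprocal_formulaE phi_meas w_meas hP swP mB BT phiB w_lty w_neq0 sP.
  split=> [fg|fg]; first by apply: filterS2 formE fg => x -> ->.
  by apply: filterS2 formE fg => x -> [].
split; last by move=> f g /key.
by apply/seteqP; split => f [g /key fg]; exists g.
Qed.
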